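(* Let $m\ge 2$ and let $G$ be a finite graph (loops and multiple edges allowed). The chromatic homology $\bigoplus_{i,j}H^{i,j}_{\mathcal{A}_m}(G)$ contains nonzero torsion if and only if $G$ has no loops and contains a cycle of length at least $3$. In this case, $H^{*,*}_{\mathcal{A}_m}(G)$ has torsion of order dividing $m$.
   Context: $\mathcal{A}_m=\mathbb{Z}[x]/(x^m)$. Fix a total order on $E(G)$. An enhanced state is $(H,\epsilon)$ with $H$ a spanning subgraph ($V(H)=V(G)$, $E(H)\subseteq E(G)$) and $\epsilon$ assigning to each connected component of $H$ an element of $\{1,x,\dots,x^{m-1}\}$. $C^{i}$ is free abelian on enhanced states with $|E(H)|=i$, with quantum grading $j$ the sum of the exponents of $\epsilon$. The differential is $d(H,\epsilon)=\sum_{e\notin E(H)}(-1)^{\#\{e'\in E(H):e'<e\}}(H\cup e,\epsilon_e)$, where if $e$ joins two distinct components $C_1,C_2$ the merged component gets $\epsilon(C_1)\epsilon(C_2)\in\mathcal{A}_m$ (term zero if this product is $0$), and if $e$ joins two vertices of one component then $\epsilon_e=\epsilon$. $H^{i,j}_{\mathcal{A}_m}(G)$ denotes its homology. *)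

(* Defs.v *)
From HB Require Import structures.
From mathcomp Require Import all_boot all_order all_algebra.
From mathcomp Require Import generic_quotient ring_quotient.
From mathcomp Require Import boolp.

Set Implicit Arguments.
Unset Strict Implicit.
Unset Printing Implicit Defensive.

Import GRing.Theory.
Local Open Scope ring_scope.

(* The two endpoints of an edge are stored as a pair whose order plays no role;
   equal endpoints encode a loop. *)
Record multigraph := Multigraph {
  vertex : finType;
  edge : finType;
  ends : edge -> vertex * vertex
}.

Section Graph.
Variable G : multigraph.
Implicit Types (e : edge G) (u v : vertex G) (H : {set edge G}).

Definition joins e u v := (ends e == (u, v)) || (ends e == (v, u)).

Definition loopless := forall e, (ends e).1 <> (ends e).2.

(* A loop is a cycle of length 1, a pair of parallel edges one of length 2. *)
Definition has_cycle (k : nat) :=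
  exists (v : 'I_k -> vertex G) (e : 'I_k -> edge G),
    [/\ injective v, injective e & forall i, joins (e i) (v i) (v (ordS i))].

(* A spanning subgraph is identified with its edge set H. *)
Definition adj H : rel (vertex G) := [rel u v | [exists e in H, joins e u v]].

Definition component H v : {set vertex G} := [set u | connect (adj H) v u].

Definition components H : {set {set vertex G}} := [set component H v | v in vertex G].

Definition component_type H := {C : {set vertex G} | C \in components H}.

Lemma mem_component H v : component H v \in components H.
Proof. exact: imset_f. Qed.

Definition component_of H v : component_type H :=
  exist _ (component H v) (mem_component H v).

End Graph.

Section Complex.
Variables (G : multigraph) (leE : rel (edge G)) (m : nat).

(* The label x^k of a component is represented by its exponent k : 'I_m. *)
Definition state := {H : {set edge G} & {ffun component_type H -> 'I_m}}.

Implicit Types (s t : state) (e : edge G) (v : vertex G).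

Definition edges s : {set edge G} := tag s.
Definition label s : component_type (edges s) -> 'I_m := tagged s.
Definition exponent s v : nat := label (component_of (edges s) v).
Definition height s : nat := #|edges s|.
Definition qdeg s : nat := (\sum_(C : component_type (edges s)) label C)%N.

(* Exponent, before reduction modulo x^m, of the label that adding e to s gives
   to the component of v. *)
Definition added_exponent s e v : nat :=
  let C1 := component (edges s) (ends e).1 in
  let C2 := component (edges s) (ends e).2 in
  if (C1 != C2) && (v \in C1 :|: C2)
  then (exponent s (ends e).1 + exponent s (ends e).2)%N
  else exponent s v.

(* t is the enhanced state (H u e, eps_e).  At most one t qualifies; since all
   labels of t have exponent < m, none does exactly when the product of the two
   merged labels is 0 in Z[x]/(x^m). *)
Definition adds s e t : bool :=
  (edges t == e |: edges s) && [forall v, exponent t v == added_exponent s e v].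

Definition edge_sign s e : int :=
  (-1) ^+ #|[set e' in edges s | (e' != e) && leE e' e]|.

(* Integer-valued functions on the finite set of enhanced states, i.e. the free
   abelian group on it. *)
Local Notation chain := {ffun state -> int}.

Definition basis s : chain := [ffun t => (t == s)%:R].

Definition diff_state s : chain :=
  \sum_(e | e \notin edges s) \sum_(t | adds s e t) basis t *~ edge_sign s e.

Definition diff (c : chain) : chain := \sum_s diff_state s *~ c s.

Lemma diff_is_zmod_morphism : zmod_morphism diff.
Proof.
move=> b c; rewrite /diff -sumrB; apply: eq_bigr => s _.
by rewrite !ffunE mulrzBr.
Qed.
HB.instance Definition _ :=
  GRing.isZmodMorphism.Build chain chain diff diff_is_zmod_morphism.

Definition supported (P : pred state) : {pred chain} :=
  [pred c : chain | [forall s, (c s != 0) ==> P s]].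

Lemma supported_zmod_closed P : zmod_closed (supported P).
Proof.
split=> [|b c /forallP bP /forallP cP]; apply/forallP => s.
  by rewrite ffunE eqxx.
apply/implyP; rewrite !ffunE => bc; have := bP s; have := cP s.
case: (eqVneq (c s) 0) bc => [->|_ _ //]; rewrite subr0 => bs _.
by rewrite bs.
Qed.
HB.instance Definition _ P :=
  GRing.isZmodClosed.Build chain (supported P) (supported_zmod_closed P).

Section Homology.
Variable ij : nat * nat.

Definition in_bidegree : pred state := fun s => (height s, qdeg s) == ij.

(* Bidegree (i - 1, j); no state qualifies when i = 0. *)
Definition in_prev_bidegree : pred state :=
  fun s => ((height s).+1, qdeg s) == ij.

Definition is_cocycle : {pred chain} :=
  [pred c : chain | (c \in supported in_bidegree) && (diff c == 0)].

Lemma is_cocycle_zmod_closed : zmod_closed is_cocycle.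
Proof.
split=> [|b c /andP[bP /eqP b0] /andP[cP /eqP c0]]; apply/andP; split.
- exact: rpred0.
- by rewrite raddf0.
- exact: rpredB.
- by rewrite raddfB /= b0 c0 subr0.
Qed.
HB.instance Definition _ :=
  GRing.isZmodClosed.Build chain is_cocycle is_cocycle_zmod_closed.

Record cocycle := Cocycle { cocycle_val :> chain; _ : cocycle_val \in is_cocycle }.
HB.instance Definition _ := [isSub for cocycle_val].
HB.instance Definition _ := [Choice of cocycle by <:].
HB.instance Definition _ := [SubChoice_isSubZmodule of cocycle by <:].

Definition is_coboundary : {pred cocycle} :=
  [pred z : cocycle |
    `[< exists2 b : chain, b \in supported in_prev_bidegree & diff b = z >]].

Lemma is_coboundary_zmod_closed : zmod_closed is_coboundary.
Proof.
split=> [|y z /asboolP[b bP bE] /asboolP[c cP cE]]; apply/asboolP.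
  by exists 0; rewrite ?rpred0 ?raddf0.
by exists (b - c); rewrite ?rpredB // raddfB /= bE cE.
Qed.
HB.instance Definition _ :=
  GRing.isZmodClosed.Build cocycle is_coboundary is_coboundary_zmod_closed.

Definition homology : zmodType := Quotient.quot is_coboundary.

End Homology.
End Complex.

Section DirectSum.
Variables (I : eqType) (A : I -> zmodType).

Definition dep_prod := forall i, A i.
HB.instance Definition _ := Choice.on dep_prod.

Implicit Types f g h : dep_prod.

Definition dep_prod_zero : dep_prod := fun=> 0.
Definition dep_prod_opp f : dep_prod := fun i => - f i.
Definition dep_prod_add f g : dep_prod := fun i => f i + g i.

Lemma dep_prod_addA : associative dep_prod_add.
Proof. by move=> f g h; apply: functional_extensionality_dep => i; exact: addrA. Qed.
Lemma dep_prod_addC : commutative dep_prod_add.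
Proof. by move=> f g; apply: functional_extensionality_dep => i; exact: addrC. Qed.
Lemma dep_prod_add0 : left_id dep_prod_zero dep_prod_add.
Proof. by move=> f; apply: functional_extensionality_dep => i; exact: add0r. Qed.
Lemma dep_prod_addN : left_inverse dep_prod_zero dep_prod_opp dep_prod_add.
Proof. by move=> f; apply: functional_extensionality_dep => i; exact: addNr. Qed.
HB.instance Definition _ :=
  GRing.isZmodule.Build dep_prod dep_prod_addA dep_prod_addC dep_prod_add0 dep_prod_addN.

Definition finitely_supported : {pred dep_prod} :=
  [pred f : dep_prod | `[< exists r : seq I, forall i, i \notin r -> f i = 0 >]].

Lemma finitely_supported_zmod_closed : zmod_closed finitely_supported.
Proof.
split=> [|f g /asboolP[r fr] /asboolP[q gq]]; apply/asboolP; first by exists [::].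
exists (r ++ q) => i; rewrite mem_cat negb_or => /andP[ir iq].
by rewrite -[LHS]/(f i - g i) fr // gq // subr0.
Qed.
HB.instance Definition _ :=
  GRing.isZmodClosed.Build dep_prod finitely_supported finitely_supported_zmod_closed.

Record dsum := Dsum { dsum_val : dep_prod; _ : dsum_val \in finitely_supported }.
HB.instance Definition _ := [isSub for dsum_val].
HB.instance Definition _ := [Choice of dsum by <:].
HB.instance Definition _ := [SubChoice_isSubZmodule of dsum by <:].

End DirectSum.

Definition chromatic_homology (G : multigraph) (leE : rel (edge G)) (m : nat) :
  zmodType := dsum (@homology G leE m).

Definition has_order (A : zmodType) (a : A) (n : nat) :=
  [/\ (0 < n)%N, a *+ n = 0 & forall k, (0 < k < n)%N -> a *+ k <> 0].

Definition has_torsion (A : zmodType) :=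
  exists (a : A) (n : nat), a <> 0 /\ has_order a n.

Definition has_torsion_dividing (A : zmodType) (m : nat) :=
  exists (a : A) (n : nat), [/\ a <> 0, has_order a n & (n %| m)%N].

(* Main.v *)
(* Write a basis state as a monomial in vertex weights w : V -> nat, a component
   being labelled by x to the sum of its weights; adding an edge then leaves w
   unchanged, and the differential is d = sum_e d_e with anticommuting d_e.

   No torsion. Deleting a loop, or an edge at a vertex with a single neighbour
   (moving the weight of that vertex to the neighbour), is a contracting homotopy
   up to chains that avoid the vertex. By induction the complex of a graph that
   has a loop, or that has no cycle of length >= 3, is exact in positive height,
   and in height 0 homology is a subgroup of a free group.

   Torsion. Take a shortest cycle v_0, ..., v_(n-1), n >= 3, in a loopless graph,
   and let D be the composite of the differentials along the edge classes of the
   induced path v_2 - ... - v_(n-1). For a suitable chain b of edgeless states,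
   d (D b) = m z up to sign: edges inside the path die since D anticommutes with
   them and squares are 0, edges leaving the path contribute cancelling pairs, and
   an edge outside the path contributes each of its monomials m times. To see that
   z is not a boundary, let C be the edge set of the cycle and send a state on
   C - {e_i, e_j} of weight m on the cycle to a sign times the exponent of one of
   its two arcs: modulo m this is well defined, it vanishes on boundaries, and it
   takes the value 1 or -1 on z. *)
From HB Require Import structures.
Require Import Defs.
From mathcomp Require Import all_boot all_order all_algebra.
From mathcomp Require Import generic_quotient ring_quotient boolp zify.

Set Implicit Arguments.
Unset Strict Implicit.
Unset Printing Implicit Defensive.

Import GRing.Theory.
Local Open Scope ring_scope.

(** * Connectivity of spanning subgraphs and weight sums over components *)

Section Connectivity.
Variable G : multigraph.
Implicit Types (e : edge G) (u v : vertex G) (H : {set edge G}).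
Implicit Types w : vertex G -> nat.

Lemma joinsC e u v : joins e u v = joins e v u.
Proof. by rewrite /joins orbC. Qed.

Lemma joins_ends e : joins e (ends e).1 (ends e).2.
Proof. by rewrite /joins -surjective_pairing eqxx. Qed.

Lemma joins_inv e u v x y : joins e u v -> joins e x y ->
  (u = x /\ v = y) \/ (u = y /\ v = x).
Proof. by rewrite /joins => /orP[] /eqP-> /orP[] /eqP[-> ->]; [left|right|right|left]. Qed.

Lemma adjP H u v : reflect (exists2 e, e \in H & joins e u v) (adj H u v).
Proof. exact: exists_inP. Qed.

Lemma connect_adj_sym H : connect_sym (adj H).
Proof.
by apply: sym_connect_sym => u v; apply: eq_existsb => e; rewrite joinsC.
Qed.

Lemma connect_joins H e u v : e \in H -> joins e u v -> connect (adj H) u v.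
Proof. by move=> eH euv; apply/connect1/adjP; exists e. Qed.

Lemma connect_adjS H H' u v :
  H \subset H' -> connect (adj H) u v -> connect (adj H') u v.
Proof.
move=> /subsetP HH'; apply: connect_sub => x y /adjP[e eH exy].
exact: connect_joins (HH' _ eH) exy.
Qed.

Lemma component_eq H u v : (component H u == component H v) = connect (adj H) u v.
Proof.
apply/eqP/idP => [/setP/(_ v)|uv].
  by rewrite !inE connect0 => ->.
by apply/setP => x; rewrite !inE (same_connect (@connect_adj_sym H) uv).
Qed.

Lemma connect_invariant (T : Type) (f : vertex G -> T) H u v :
  (forall e x y, e \in H -> joins e x y -> f x = f y) ->
  connect (adj H) u v -> f u = f v.
Proof.
move=> fH /connectP[p pP ->]; elim: p u pP => //= x p IH u /andP[/adjP[e eH ux]].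
by move=> /IH <-; exact: fH eH ux.
Qed.

(** The exponent that the vertex weights [w] give to the label of the component of [v], before
    truncation at x^m. *)
Definition csum H w v := (\sum_(u in component H v) w u)%N.

Lemma csum_connect H w u v : connect (adj H) u v -> csum H w u = csum H w v.
Proof. by rewrite -component_eq /csum => /eqP->. Qed.

Lemma csum_ge2 H w u u' v : connect (adj H) v u -> connect (adj H) v u' ->
  u != u' -> (w u + w u' <= csum H w v)%N.
Proof.
move=> vu vu' uu'; rewrite /csum (bigD1 u) ?inE //= leq_add2l.
by rewrite (bigD1 u') ?inE ?vu' 1?eq_sym //= leq_addr.
Qed.

Lemma csum_isolated H w v :
  (forall e u, e \in H -> ~~ joins e v u) -> csum H w v = w v.
Proof.
move=> vH; have cv u : connect (adj H) v u = (u == v).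
  apply/idP/eqP => [/connectP[[|x p] /= pP ->]//|-> //].
  by case/andP: pP => /adjP[e eH vx]; rewrite (negPf (vH _ _ eH)) in vx.
by rewrite /csum (eq_bigl (pred1 v)) ?big_pred1_eq // => u; rewrite inE cv.
Qed.

(** A set closed under connection in [H] is a disjoint union of components of [H], and the sums
    agree on each of them. *)
Lemma closed_sum_eq H w w' (A : {set vertex G}) :
  (forall u v, connect (adj H) u v -> u \in A -> v \in A) ->
  (forall v, csum H w v = csum H w' v) ->
  (\sum_(u in A) w u = \sum_(u in A) w' u)%N.
Proof.
move=> Acl ww'; rewrite (partition_big (component H) predT) //=.
rewrite [RHS](partition_big (component H) predT) //=.
apply: eq_bigr => C _.
case: (pickP [pred u | (u \in A) && (component H u == C)]) => [u /andP[uA /eqP uC]|nA].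
  have E x : (x \in A) && (component H x == C) = (x \in component H u).
    rewrite -uC component_eq inE connect_adj_sym.
    by apply: andb_idl => ux; exact: Acl ux uA.
  by have := ww' u; rewrite /csum (eq_bigl _ _ E) (eq_bigl _ w' E).
by rewrite !big_pred0.
Qed.

Lemma csum_eqS H H' w w' : H \subset H' ->
  (forall v, csum H w v = csum H w' v) -> forall v, csum H' w v = csum H' w' v.
Proof.
move=> HH' ww' v; apply: (@closed_sum_eq H) => // x y xy.
by rewrite !inE => /connect_trans; apply; exact: connect_adjS xy.
Qed.

Lemma csumS H H' w v : H \subset H' -> (csum H w v <= csum H' w v)%N.
Proof.
move=> HH'; rewrite /csum [leqRHS](big_setID (component H v)) /=.
rewrite (setIidPr _) ?leq_addr //.
by apply/subsetP => u; rewrite !inE; exact: connect_adjS.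
Qed.

Lemma connect_addE H e v u : connect (adj (e |: H)) v u =
  let C1 := component H (ends e).1 in let C2 := component H (ends e).2 in
  if v \in C1 :|: C2 then u \in C1 :|: C2 else connect (adj H) v u.
Proof.
cbv zeta; set C1 := component H (ends e).1; set C2 := component H (ends e).2.
(* [f] collapses the two components at the ends of [e] and keeps all others apart, so it is constant
   along every edge of [e |: H]. *)
set f := fun u => if u \in C1 :|: C2 then None else Some (component H u).
have cl x y : connect (adj H) x y -> (x \in C1 :|: C2) = (y \in C1 :|: C2).
  by move=> xy; rewrite !inE !(same_connect_r (@connect_adj_sym H) xy).
have sub : H \subset e |: H by exact: subsetUr.
have ends12 : connect (adj (e |: H)) (ends e).1 (ends e).2.
  by apply: connect_joins (joins_ends e); rewrite setU11.
have inC x : x \in C1 :|: C2 -> connect (adj (e |: H)) (ends e).1 x.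
  rewrite !inE => /orP[/(connect_adjS sub)//|/(connect_adjS sub)].
  exact: connect_trans.
have fP : connect (adj (e |: H)) v u -> f v = f u.
  apply: connect_invariant => e' x y /setU1P[->|e'H] xy; rewrite /f.
    have [] := joins_inv xy (joins_ends e) => -[-> ->];
      by rewrite !inE !connect0 ?orbT.
  have cxy := connect_joins e'H xy; rewrite (cl _ _ cxy).
  by case: ifP => // _; congr Some; apply/eqP; rewrite component_eq.
case: ifP => vC.
  apply/idP/idP => [/fP|uC]; first by rewrite /f vC; case: ifP.
  apply: connect_trans (inC _ uC); rewrite connect_adj_sym; exact: inC.
apply/idP/idP => [/fP|/(connect_adjS sub)//].
rewrite /f vC; case: ifP => // _ [] /eqP; by rewrite component_eq.
Qed.

(** Shaped like [added_exponent], so that one weight function describes the labels both before and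
    after an edge is added. *)
Lemma csum_add H e w v : csum (e |: H) w v =
  let C1 := component H (ends e).1 in let C2 := component H (ends e).2 in
  if (C1 != C2) && (v \in C1 :|: C2)
  then (csum H w (ends e).1 + csum H w (ends e).2)%N else csum H w v.
Proof.
cbv zeta; set C1 := component H (ends e).1; set C2 := component H (ends e).2.
have E u : u \in component (e |: H) v =
    if v \in C1 :|: C2 then u \in C1 :|: C2 else connect (adj H) v u.
  by rewrite inE connect_addE.
rewrite {1}/csum (eq_bigl _ _ E); case: (boolP (v \in _)) => vC; last first.
  by rewrite andbF; apply: eq_bigl => u; rewrite inE.
rewrite andbT; case: eqP => [C12|/eqP C12] /=.
  move: vC; rewrite -/C1 -/C2 -C12 setUid => vC.
  by rewrite (@csum_connect _ _ v (ends e).1) // connect_adj_sym; rewrite inE in vC.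
rewrite -bigU /=; first by apply: eq_bigl => u; rewrite !inE.
apply/pred0P => u /=; apply/negP; rewrite !inE => /andP[a b].
case/negP: C12; rewrite component_eq; apply: connect_trans a _.
by rewrite connect_adj_sym.
Qed.

End Connectivity.

(** * Enhanced states as edge sets with exponents constant on components *)

Section Monomials.
Variables (G : multigraph) (m' : nat).
Local Notation m := m'.+1.
Local Notation chain := {ffun state G m -> int}.
Implicit Types (e : edge G) (u v : vertex G) (H : {set edge G}).
Implicit Types (w : vertex G -> nat) (s t : state G m) (c : chain).

Lemma exponent_connect s u v :
  connect (adj (edges s)) u v -> exponent s u = exponent s v.
Proof.
rewrite -component_eq /exponent => /eqP uv.
by congr (nat_of_ord (label _)); apply: val_inj.
Qed.

Lemma component_ofP H (C : component_type H) : exists v, C = component_of H v.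
Proof. by case: C => C CH; have /imsetP[v _ Cv] := CH; exists v; apply: val_inj. Qed.

Lemma state_ext s t : edges s = edges t -> exponent s =1 exponent t -> s = t.
Proof.
case: s t => [H f] [K g]; rewrite /edges /= => HK; rewrite -{}HK in g * => fg.
congr (Tagged _); apply/ffunP => C; have [v ->] := component_ofP C.
exact/val_inj/fg.
Qed.

(** Each label is read at a picked vertex, so [f] is meant to be constant on components with values
    below [m]. The default [ord0] never occurs, because components are nonempty. *)
Definition mkstate H (f : vertex G -> nat) : state G m :=
  Tagged (fun H => {ffun component_type H -> 'I_m})
    [ffun C : component_type H => if [pick v in val C] is Some v
                                  then inord (f v) : 'I_m else ord0].

Lemma exponent_mkstate H f v :
  (forall u, connect (adj H) v u -> f u = f v) -> (f v < m)%N ->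
  exponent (mkstate H f) v = f v.
Proof.
move=> fv fm; rewrite /exponent /label /= ffunE; case: pickP => [u|/(_ v)].
  by rewrite inE => /fv ->; rewrite inordK.
by rewrite inE connect0.
Qed.

End Monomials.

(* The basis state with edge set H whose components carry the products of the
   vertex labels x^(w v); it is 0 when one of these products is. *)
HB.lock Definition mono (G : multigraph) (m' : nat) (H : {set edge G})
    (w : vertex G -> nat) : {ffun state G m'.+1 -> int} :=
  [ffun t => ((edges t == H) && [forall v, exponent t v == csum H w v])%:R].

(** A canonical weight representing [s]: the exponent of each component is concentrated at one
    representative vertex, so component sums recover the labels. *)
Definition wt (G : multigraph) (m : nat) (s : state G m) (v : vertex G) : nat :=
  if fingraph.root (adj (edges s)) v == v then exponent s v else 0%N.

HB.lock Definition lext (G : multigraph) (m' : nat) (U : zmodType)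
    (g : {set edge G} -> (vertex G -> nat) -> U) (c : {ffun state G m'.+1 -> int}) : U :=
  \sum_s g (edges s) (wt s) *~ c s.

(** * Monomial calculus and linear maps defined on monomials *)

Section MonomialTheory.
Variables (G : multigraph) (m' : nat).
Local Notation m := m'.+1.
Local Notation chain := {ffun state G m -> int}.
Local Notation mono := (@mono G m').
Implicit Types (e : edge G) (u v : vertex G) (H : {set edge G}).
Implicit Types (w : vertex G -> nat) (s t : state G m) (c : chain).

Lemma monoE H w t :
  mono H w t = ((edges t == H) && [forall v, exponent t v == csum H w v])%:R.
Proof. by rewrite mono.unlock ffunE. Qed.

Lemma csum_wt s v : csum (edges s) (wt s) v = exponent s v.
Proof.
have sym := @connect_adj_sym _ (edges s).
have vr := connect_root (adj (edges s)) v.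
rewrite /csum (bigD1 (fingraph.root (adj (edges s)) v)) ?inE //= big1 => [|u].
  by rewrite addn0 /wt (fingraph.root_root sym) eqxx (exponent_connect vr).
rewrite inE => /andP[vu uv]; rewrite /wt; case: eqP => // ru.
by case/eqP: uv; rewrite -ru (fingraph.rootP sym vu).
Qed.

Lemma basis_mono s : basis s = mono (edges s) (wt s).
Proof.
apply/ffunP => t; rewrite monoE ffunE; congr (nat_of_bool _)%:R.
apply/eqP/andP => [->|[/eqP st /forallP ex]].
  by split=> //; apply/forallP => v; rewrite csum_wt.
by apply: state_ext => // v; rewrite (eqP (ex v)) csum_wt.
Qed.

Lemma mono_ext H w w' : (forall v, csum H w v = csum H w' v) -> mono H w = mono H w'.
Proof.
move=> ww'; apply/ffunP => t; rewrite !monoE; congr (nat_of_bool (_ && _))%:R.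
by apply: eq_forallb => v; rewrite ww'.
Qed.

Lemma mono_over H w v : (m <= csum H w v)%N -> mono H w = 0.
Proof.
move=> over; apply/ffunP => t; rewrite monoE ffunE; case: andP => // -[_ /forallP/(_ v)].
by move=> /eqP E; move: over; rewrite -E leqNgt ltn_ord.
Qed.

Lemma mono_basis H w : (forall v, csum H w v < m)%N -> exists s,
  [/\ edges s = H, (forall v, csum H (wt s) v = csum H w v) & mono H w = basis s].
Proof.
move=> wm; pose s := mkstate m' H (csum H w).
have ex v : exponent s v = csum H w v.
  apply: exponent_mkstate => // u vu.
  by rewrite (csum_connect _ vu).
have sw v : csum H (wt s) v = csum H w v by rewrite -ex -csum_wt.
by exists s; split=> //; rewrite basis_mono; exact/esym/mono_ext.
Qed.

Lemma mono_supp H w t : mono H w t != 0 ->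
  edges t = H /\ forall v, exponent t v = csum H w v.
Proof.
rewrite monoE; case: andP => [[/eqP tH /forallP tw] _|_]; last by rewrite eqxx.
by split=> // v; exact/eqP.
Qed.

Lemma mono_supported (K : pred {set edge G}) H w :
  K H -> mono H w \in supported (fun s => K (edges s)).
Proof.
move=> KH; apply/forallP => t; apply/implyP => /mono_supp[-> _]. exact: KH.
Qed.

Lemma qdeg_total s : qdeg s = (\sum_v wt s v)%N.
Proof.
rewrite /qdeg (partition_big (component_of (edges s)) predT) //=.
apply: eq_bigr => C _; have [v ->] := component_ofP C.
rewrite -[LHS]csum_wt /csum; apply: eq_bigl => u.
by rewrite inE connect_adj_sym -component_eq -val_eqE.
Qed.

Lemma qdeg_mono H w t : mono H w t != 0 -> qdeg t = (\sum_v w v)%N.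
Proof.
case/mono_supp=> tH tw; rewrite qdeg_total.
have E f : (\sum_v f v = \sum_(v in [set: vertex G]) f v)%N.
  by apply: eq_bigl => v; rewrite inE.
rewrite !E; apply: (@closed_sum_eq _ H) => [u v|v]; first by rewrite !inE.
by rewrite -tH csum_wt tH tw.
Qed.

Lemma chainMzE c (k : int) t : (c *~ k) t = c t * k.
Proof. by rewrite ffunMzE -mulrzz. Qed.

Lemma chain_basisE c : c = \sum_s basis s *~ c s.
Proof.
apply/ffunP => t; rewrite sum_ffunE.
rewrite (eq_bigr (fun s => if s == t then c s else 0)) => [|s _].
  by rewrite -big_mkcond big_pred1_eq.
by rewrite chainMzE ffunE eq_sym; case: eqP; rewrite ?mul1r ?mul0r.
Qed.

(** Every basis state is a monomial, so a linear statement need only be checked on monomials. *)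
Lemma chain_ind (K : pred {set edge G}) (Q : chain -> Prop) :
  Q 0 -> (forall a b k, Q a -> Q b -> Q (a *~ k + b)) ->
  (forall H w, K H -> Q (mono H w)) ->
  forall c, c \in supported (fun s => K (edges s)) -> Q c.
Proof.
move=> Q0 QD QM c /forallP cK; rewrite (chain_basisE c).
elim: (index_enum _) => [|s r IH]; rewrite ?big_nil // big_cons.
set X := \sum_(j <- r) _ in IH *.
have [c0|/(implyP (cK s)) Ks] := eqVneq (c s) 0.
  by rewrite c0 mulr0z add0r.
by apply: QD; [rewrite basis_mono; exact: QM|exact: IH].
Qed.

Section LinearExtension.
Variable (U : zmodType).
Implicit Type g : {set edge G} -> (vertex G -> nat) -> U.

Lemma lext_is_zmod_morphism g : zmod_morphism (lext g : chain -> U).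
Proof.
move=> b c; rewrite !lext.unlock -sumrB; apply: eq_bigr => s _.
by rewrite -mulrzBr !ffunE.
Qed.
HB.instance Definition _ g :=
  GRing.isZmodMorphism.Build chain U (@lext G m' U g) (lext_is_zmod_morphism g).

(** What [g] must satisfy at [H] to descend from weights to chains: it sees only component labels,
    and it respects x^m = 0. *)
Definition label_invariant g H :=
  (forall w w', (forall v, csum H w v = csum H w' v) -> g H w = g H w') /\
  (forall w v, (m <= csum H w v)%N -> g H w = 0).

Lemma lext_mono g H w : label_invariant g H -> lext g (mono H w) = g H w.
Proof.
case=> gE g0; case: (boolP [forall v, csum H w v < m]%N) => [/forallP/mono_basis|].
  case=> s [sH sw ->]; rewrite lext.unlock.
  rewrite (eq_bigr (fun t => if t == s then g H w else 0)) => [|t _].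
    by rewrite -big_mkcond big_pred1_eq.
  by rewrite ffunE; case: eqP => [->|_]; rewrite ?mulr1z ?mulr0z // sH; exact: gE.
rewrite negb_forall => /existsP[v]; rewrite -leqNgt => over.
by rewrite (mono_over over) (g0 _ _ over) raddf0.
Qed.

End LinearExtension.
End MonomialTheory.

(** * Signs, partial differentials along edges and their anticommutation *)

HB.lock Definition sgn (G : multigraph) (leE : rel (edge G)) (H : {set edge G})
    (e : edge G) : int :=
  (-1) ^+ #|[set e' in H | (e' != e) && leE e' e]|.

HB.lock Definition d1 (G : multigraph) (leE : rel (edge G)) (m' : nat) (e : edge G)
    (c : {ffun state G m'.+1 -> int}) : {ffun state G m'.+1 -> int} :=
  lext (fun H w => if e \in H then 0 else mono m' (e |: H) w *~ sgn leE H e) c.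

HB.lock Definition dA (G : multigraph) (leE : rel (edge G)) (m' : nat)
    (A : {set edge G}) (c : {ffun state G m'.+1 -> int}) : {ffun state G m'.+1 -> int} :=
  \sum_(e in A) d1 leE e c.

Section PartialDifferentials.
Variables (G : multigraph) (leE : rel (edge G)) (m' : nat).
Hypotheses (leE_total : total leE) (leE_anti : antisymmetric leE).
Local Notation m := m'.+1.
Local Notation chain := {ffun state G m -> int}.
Local Notation mono := (@mono G m').
Local Notation sgn := (sgn leE).
Local Notation d1 := (@d1 G leE m').
Local Notation dA := (@dA G leE m').
Implicit Types (e f : edge G) (u v : vertex G) (H A B : {set edge G}).
Implicit Types (w : vertex G -> nat) (s t : state G m) (c : chain).

Lemma sgn_sqr H e : sgn H e * sgn H e = 1.
Proof. by rewrite sgn.unlock -expr2 sqrr_sign. Qed.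

Lemma sgn_add H e f : e \notin H -> e != f ->
  sgn (e |: H) f = sgn H f * (-1) ^+ leE e f.
Proof.
move=> eH ef; rewrite !sgn.unlock -exprD; congr (_ ^+ _).
set X := [set _ in H | _].
have -> : [set e' in e |: H | (e' != f) && leE e' f] =
    if leE e f then e |: X else X.
  apply/setP => x; case: (boolP (leE e f)) => le_ef; rewrite !inE.
    by case: (eqVneq x e) => [->|] //=; rewrite ef le_ef.
  by case: (eqVneq x e) => [->|] //=; rewrite (negPf le_ef) !andbF.
case: (leE e f); rewrite ?addn0 // cardsU1 addnC; congr (_ + _)%N.
by rewrite inE (negPf eH).
Qed.

Lemma leE_xor e f : e != f -> leE e f = ~~ leE f e.
Proof.
move=> ef; have := leE_total e f; have := @leE_anti e f.
by case: (leE e f); case: (leE f e) => //= /(_ isT) E; rewrite E eqxx in ef.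
Qed.

(** Exactly one of [e], [f] precedes the other, so exactly one of the two second signs is flipped by
    the edge added first. *)
Lemma sgn_swap H e f : e \notin H -> f \notin H -> e != f ->
  sgn H e * sgn (e |: H) f = - (sgn H f * sgn (f |: H) e).
Proof.
move=> eH fH ef; rewrite !sgn_add // 1?eq_sym // (leE_xor ef) signrN.
by rewrite !mulrN mulrCA.
Qed.

Lemma d1_invariant e : forall H, label_invariant m'
  (fun H w => if e \in H then 0 else mono (e |: H) w *~ sgn H e) H.
Proof.
move=> H; split=> [w w' ww'|w v over]; case: ifP => // _.
  by rewrite (mono_ext _ (csum_eqS (subsetUr [set e] H) ww')).
rewrite (@mono_over _ _ _ _ v) ?mul0rz //.
exact: leq_trans over (csumS _ _ (subsetUr _ _)).
Qed.

Lemma d1_is_zmod_morphism e : zmod_morphism (d1 e).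
Proof. by rewrite d1.unlock => a b; rewrite raddfB. Qed.
HB.instance Definition _ e :=
  GRing.isZmodMorphism.Build chain chain (d1 e) (d1_is_zmod_morphism e).

Lemma d1_mono e H w :
  d1 e (mono H w) = if e \in H then 0 else mono (e |: H) w *~ sgn H e.
Proof. by rewrite d1.unlock lext_mono //; exact: d1_invariant. Qed.

Lemma dAE A c : dA A c = \sum_(e in A) d1 e c.
Proof. by rewrite dA.unlock. Qed.

Lemma dA_is_zmod_morphism A : zmod_morphism (dA A).
Proof. by move=> a b; rewrite !dAE -sumrB; apply: eq_bigr => e _; rewrite raddfB. Qed.
HB.instance Definition _ A :=
  GRing.isZmodMorphism.Build chain chain (dA A) (dA_is_zmod_morphism A).

Lemma chain_ind_all (Q : chain -> Prop) :
  Q 0 -> (forall a b k, Q a -> Q b -> Q (a *~ k + b)) ->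
  (forall H w, Q (mono H w)) -> forall c, Q c.
Proof.
move=> Q0 QD QM c; apply: (@chain_ind _ _ predT) => //.
by apply/forallP => s; rewrite implybT.
Qed.

Lemma d1_anti e f c : d1 e (d1 f c) = - d1 f (d1 e c).
Proof.
elim/chain_ind_all: c => [|a b k Ea Eb|H w]; first by rewrite !raddf0.
  by rewrite !raddfD !raddfMz /= Ea Eb mulNrz.
rewrite !d1_mono; case eH: (e \in H); case fH: (f \in H);
  rewrite ?raddf0 ?raddfMz ?oppr0 //= !d1_mono !inE ?eH ?fH ?orbT ?mul0rz ?oppr0 //.
  by rewrite mul0rz.
rewrite !orbF (eq_sym f e); case: eqVneq => [_|ef]; first by rewrite ?oppr0 !mul0rz ?oppr0.
rewrite ?mulNrz -!mulrzA -mulrNz setUCA; congr (_ *~ _).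
by rewrite mulrC [X in - X]mulrC sgn_swap ?opprK ?eH ?fH // eq_sym.
Qed.

Lemma dA_anti A B c : dA A (dA B c) = - dA B (dA A c).
Proof.
rewrite !dAE.
under eq_bigr do rewrite raddf_sum.
under [in RHS]eq_bigr do rewrite raddf_sum.
rewrite exchange_big -sumrN; apply: eq_bigr => e _; rewrite -sumrN.
by apply: eq_bigr => f _; exact: d1_anti.
Qed.

Lemma chain_torsion_free c k : (0 < k)%N -> c *+ k = 0 -> c = 0.
Proof.
move=> k0 /ffunP ck; apply/ffunP => t; have := ck t; rewrite ffunMnE !ffunE.
by move/eqP; rewrite Num.Theory.mulrn_eq0 -leqn0 leqNgt k0 => /eqP.
Qed.

(** Anticommuting with itself makes twice the square zero, and chains have integer coefficients. *)
Lemma dA_sqr A c : dA A (dA A c) = 0.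
Proof.
apply: (@chain_torsion_free _ 2) => //.
by rewrite mulr2n {2}dA_anti subrr.
Qed.

Lemma dAU A B c : [disjoint A & B] -> dA (A :|: B) c = dA A c + dA B c.
Proof. by move=> dAB; rewrite !dAE -bigU //; apply: eq_bigl => e; rewrite !inE. Qed.

Lemma added_exponentE s e v :
  added_exponent s e v = csum (e |: edges s) (wt s) v.
Proof. by rewrite csum_add /added_exponent !csum_wt. Qed.

(** At most one state [t] qualifies. When the product of labels vanishes none does, and the monomial
    on the right is then zero as well. *)
Lemma sum_adds s e : \sum_(t | adds s e t) basis t = mono (e |: edges s) (wt s).
Proof.
apply/ffunP => t; rewrite sum_ffunE monoE.
rewrite (eq_bigr (fun x => if x == t then 1 else 0)) => [|x _]; last first.
  by rewrite ffunE eq_sym; case: eqP.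
rewrite -big_mkcondr /=.
have -> : (edges t == e |: edges s) &&
    [forall v, exponent t v == csum (e |: edges s) (wt s) v] = adds s e t.
  by congr (_ && _); apply: eq_forallb => v; rewrite -added_exponentE.
case: (boolP (adds s e t)) => at_.
  rewrite (eq_bigl (pred1 t)) ?big_pred1_eq // => x /=.
  by case: eqP => [->|]; rewrite ?at_ ?andbF.
by rewrite big_pred0 // => x; apply: contraNF at_ => /andP[ax /eqP <-].
Qed.

Lemma diff_dA c : diff leE c = dA setT c.
Proof.
have diff_basis s : diff_state leE s = dA setT (basis s).
  rewrite /diff_state dAE [LHS]big_mkcond; apply: eq_big => [e|e _].
    by rewrite inE.
  rewrite basis_mono d1_mono -sum_adds if_neg; case: ifP => // _.
  rewrite mulrz_suml; apply: eq_bigr => t _; by rewrite sgn.unlock.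
rewrite [in RHS](chain_basisE c) raddf_sum; apply: eq_bigr => s _.
by rewrite raddfMz diff_basis.
Qed.

End PartialDifferentials.

(** * Exactness in positive height and the deletion homotopy *)

Section Exactness.
Variables (G : multigraph) (leE : rel (edge G)) (m' : nat).
Hypotheses (leE_total : total leE) (leE_anti : antisymmetric leE).
Local Notation m := m'.+1.
Local Notation chain := {ffun state G m -> int}.
Local Notation mono := (@mono G m').
Local Notation sgn := (sgn leE).
Local Notation d1 := (@d1 G leE m').
Local Notation dA := (@dA G leE m').
Implicit Types (e f : edge G) (u v : vertex G) (H A B S T : {set edge G}).
Implicit Types (w : vertex G -> nat) (s t : state G m) (b c : chain).
Implicit Type K : pred {set edge G}.

Definition esupp K : {pred chain} := supported (fun s => K (edges s)).

Lemma esupp_sum K (I : Type) (r : seq I) (P : pred I) (F : I -> chain) :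
  (forall i, P i -> F i \in esupp K) -> \sum_(i <- r | P i) F i \in esupp K.
Proof. exact: rpred_sum. Qed.

Lemma esupp_lin K a b k : a \in esupp K -> b \in esupp K -> a *~ k + b \in esupp K.
Proof. by move=> aK bK; apply: rpredD => //; exact: rpredMz. Qed.

Lemma esuppB K a b : a \in esupp K -> b \in esupp K -> a - b \in esupp K.
Proof. exact: rpredB. Qed.

Lemma esuppD K a b : a \in esupp K -> b \in esupp K -> a + b \in esupp K.
Proof. exact: rpredD. Qed.

Lemma esuppMz K a k : a \in esupp K -> a *~ k \in esupp K.
Proof. exact: rpredMz. Qed.

Lemma esupp_ind K (Q : chain -> Prop) :
  Q 0 -> (forall a b k, Q a -> Q b -> Q (a *~ k + b)) ->
  (forall H w, K H -> Q (mono H w)) -> forall c, c \in esupp K -> Q c.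
Proof. exact: chain_ind. Qed.

Lemma mono_esupp K H w : K H -> mono H w \in esupp K.
Proof. exact: mono_supported. Qed.

Lemma lext_supported K K' (g : {set edge G} -> (vertex G -> nat) -> chain) c :
  (forall H w, K H -> g H w \in esupp K') -> c \in esupp K -> lext g c \in esupp K'.
Proof.
move=> gK /forallP cK; rewrite lext.unlock; apply: esupp_sum => s _.
have [c0|cs] := eqVneq (c s) 0; first by rewrite c0 mulr0z; exact: rpred0.
by apply: rpredMz; apply: gK; exact: implyP (cK s) cs.
Qed.

Lemma dA_supported K K' A c :
  (forall H e, K H -> e \in A -> K' (e |: H)) -> c \in esupp K -> dA A c \in esupp K'.
Proof.
move=> KK' cK; rewrite dAE; apply: esupp_sum => e eA; rewrite d1.unlock.
apply: lext_supported cK => H w KH; case: ifP => _; first exact: rpred0.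
by apply: esuppMz; apply: mono_esupp; exact: KK'.
Qed.

Lemma esupp_disjoint K K' b c : (forall H, K H -> K' H -> False) ->
  b \in esupp K -> c \in esupp K' -> b + c = 0 -> b = 0.
Proof.
move=> KK' /forallP bK /forallP cK /ffunP bc; apply/ffunP => s; rewrite ffunE.
have := bc s; rewrite !ffunE.
have [//|/(implyP (bK s)) Ks] := eqVneq (b s) 0.
by have [->|/(implyP (cK s)) Ks'] := eqVneq (c s) 0; [rewrite addr0|case: (KK' _ Ks Ks')].
Qed.

(** Exactness in positive height for the graph with all the vertices but only the edges in [S]. *)
Definition exact_on S := forall c,
  c \in esupp (fun H => (H \subset S) && (H != set0)) -> dA S c = 0 ->
  exists2 b, b \in esupp (fun H => H \subset S) & dA S b = c.

Lemma exact_on0 : exact_on set0.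
Proof.
move=> c /forallP c0 _; exists 0; first exact: rpred0.
rewrite raddf0; apply/ffunP => s; rewrite ffunE.
have [//|/(implyP (c0 s))/andP[]] := eqVneq (c s) 0.
by rewrite subset0 => /eqP->; rewrite eqxx.
Qed.

(* Deleting e1 is a homotopy once the labels of a subgraph containing e1 can be
   transported to its deletion; the map sh does that by moving weight across e1. *)
Section Homotopy.
Variables (S T : {set edge G}) (e1 : edge G).
Variable sh : (vertex G -> nat) -> (vertex G -> nat).
Hypotheses (TS : T \subset S) (e1T : e1 \in T).
Hypothesis sh_T : forall H w e, H \subset S -> e \in H -> e \in T ->
  forall v, csum H (sh w) v = csum H w v.
Hypothesis sh_del : forall H w w', H \subset S -> e1 \in H ->
  (forall v, csum H w v = csum H w' v) ->
  forall v, csum (H :\ e1) (sh w) v = csum (H :\ e1) (sh w') v.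
Hypothesis sh_over : forall H w v, H \subset S -> e1 \in H -> (m <= csum H w v)%N ->
  exists v', (m <= csum (H :\ e1) (sh w) v')%N.

Let e1S : e1 \in S := subsetP TS _ e1T.

(** The candidate homotopy on monomials. [sh_del] makes its value depend only on labels, and
    [sh_over] makes it zero on monomials that are zero. *)
Definition hdel H w : chain :=
  if (e1 \in H) && (H \subset S) then mono (H :\ e1) (sh w) *~ sgn (H :\ e1) e1 else 0.

Lemma hdelE H w : hdel H w =
  if (e1 \in H) && (H \subset S) then mono (H :\ e1) (sh w) *~ sgn (H :\ e1) e1 else 0.
Proof. by []. Qed.

Lemma hdel_invariant H : label_invariant m' hdel H.
Proof.
split=> [w w' ww'|w v over]; rewrite /hdel; case: ifP => // /andP[e1H HS].
  by rewrite (mono_ext _ (sh_del HS e1H ww')).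
by have [v' ov] := sh_over HS e1H over; rewrite (mono_over ov) mul0rz.
Qed.

Local Notation h := (lext hdel : chain -> chain).

Lemma h_mono H w : h (mono H w) = hdel H w.
Proof. exact/lext_mono/hdel_invariant. Qed.

Lemma h_d1_anti H w e : H \subset S -> e \in S -> e != e1 ->
  h (d1 e (mono H w)) = - d1 e (h (mono H w)).
Proof.
move=> HS eS ee1; rewrite h_mono d1_mono hdelE HS andbT.
case eH: (e \in H).
  rewrite raddf0; case: ifP => _; rewrite ?raddf0 ?oppr0 // raddfMz /= d1_mono.
  by rewrite !inE ee1 eH /= mul0rz oppr0.
rewrite raddfMz /= h_mono hdelE !inE eq_sym (negPf ee1) subUset sub1set eS HS /= andbT.
case: ifP => e1H; last by rewrite mul0rz raddf0 oppr0.
rewrite raddfMz /= d1_mono !inE ee1 eH /=.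
set K := H :\ e1; have HK : H = e1 |: K by rewrite setD1K.
have -> : (e |: H) :\ e1 = e |: K.
  by apply/setP => x; rewrite !inE; case: eqVneq => [->|]; rewrite ?orbT //= eq_sym (negPf ee1).
have eK : e \notin K by rewrite !inE eH andbF.
have e1K : e1 \notin K by rewrite !inE eqxx.
rewrite -!mulrzA -mulrNz; congr (_ *~ _).
have sw := sgn_swap leE_total leE_anti eK e1K ee1; rewrite -HK in sw.
rewrite -[LHS]mul1r -(sgn_sqr leE K e) -!mulrA [X in _ * X]mulrA sw.
by rewrite mulNr -(mulrA (sgn K e1)) sgn_sqr mulr1 mulrN.
Qed.

(** The terms for edges other than [e1] cancel by anticommutation; only adding and deleting [e1]
    itself survives. *)
Lemma homotopy H w : H \subset S -> h (dA S (mono H w)) + dA S (h (mono H w)) =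
  if e1 \in H then mono H w else mono H (sh w).
Proof.
move=> HS; rewrite !dAE raddf_sum -big_split (big_setD1 e1) //= big1 => [|e]; last first.
  by rewrite !inE => /andP[ee1 eS]; rewrite h_d1_anti // addNr.
rewrite addr0 h_mono d1_mono hdelE HS andbT; case: ifP => e1H.
  rewrite raddf0 add0r raddfMz /= d1_mono !inE eqxx /= setD1K //.
  by rewrite -mulrzA sgn_sqr mulr1z; apply: mono_ext => v; exact: sh_T e1H e1T _.
rewrite raddf0 addr0 raddfMz /= h_mono hdelE !inE eqxx subUset sub1set e1S HS /=.
by rewrite setU1K ?e1H // -mulrzA sgn_sqr mulr1z.
Qed.

(** A chain map homotopic to the identity through [h]. It kills subgraphs meeting [T], and hence has
    its values on subgraphs of [S :\: T]. *)
Definition hres c : chain := c - h (dA S c) - dA S (h c).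

Lemma hres_lin a b k : hres (a *~ k + b) = hres a *~ k + hres b.
Proof.
rewrite /hres !raddfD !raddfMz /= ?mulNrz.
by rewrite (addrACA (a *~ k)) [LHS]addrACA !mulrzBl.
Qed.

Lemma hres0 : hres 0 = 0.
Proof. by rewrite /hres !raddf0 !addr0. Qed.

Lemma hres_mono H w : H \subset S ->
  hres (mono H w) = if e1 \in H then 0 else mono H w - mono H (sh w).
Proof.
move=> HS; rewrite /hres -addrA -opprD homotopy //; case: ifP => // _.
by rewrite subrr.
Qed.

Lemma hres_meet c : c \in esupp (fun H => (H \subset S) && (H :&: T != set0)) ->
  hres c = 0.
Proof.
move: c; apply: esupp_ind => [|a b k Ea Eb|H w /andP[HS /set0Pn[e]]]; first exact: hres0.
  by rewrite hres_lin Ea Eb mul0rz addr0.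
rewrite inE => /andP[eH eT]; rewrite hres_mono //; case: ifP => // _.
by rewrite (mono_ext _ (sh_T w HS eH eT)) subrr.
Qed.

Lemma hres_supported c : c \in esupp (fun H => (H \subset S) && (H != set0)) ->
  hres c \in esupp (fun H => (H \subset S :\: T) && (H != set0)).
Proof.
move: c; apply: esupp_ind => [|a b k Ea Eb|H w /andP[HS H0]].
- by rewrite hres0; exact: rpred0.
- by rewrite hres_lin; exact: esupp_lin.
have [HT|HT] := eqVneq (H :&: T) set0; last first.
  by rewrite hres_meet; [exact: rpred0|apply: mono_esupp; rewrite HS].
have HST : H \subset S :\: T by rewrite subsetD HS -setI_eq0 HT eqxx.
rewrite hres_mono //; case: ifP => _; first exact: rpred0.
by apply: esuppB; apply: mono_esupp; rewrite HST.
Qed.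

Lemma dA_hres c : dA S (hres c) = hres (dA S c).
Proof. by rewrite /hres !raddfB /= !dA_sqr // !raddf0 !addr0. Qed.

Lemma h_supported c : c \in esupp (fun H => H \subset S) ->
  h c \in esupp (fun H => H \subset S).
Proof.
apply: lext_supported => H w HS; rewrite hdelE HS andbT; case: ifP => _; last exact: rpred0.
by apply: esuppMz; apply: mono_esupp; exact: subset_trans (subsetDl _ _) HS.
Qed.

Lemma esuppW K K' c : (forall H, K H -> K' H) -> c \in esupp K -> c \in esupp K'.
Proof.
move=> KK' /forallP cK; apply/forallP => s; apply/implyP => /(implyP (cK s)).
exact: KK'.
Qed.

Lemma dA_S_supported c : c \in esupp (fun H => H \subset S) ->
  dA S c \in esupp (fun H => H \subset S).
Proof. by apply: dA_supported => H e HS eS; rewrite subUset sub1set eS. Qed.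

(** A cocycle is replaced, up to a boundary, by its image under [hres], a cocycle of the smaller
    graph, where exactness gives a primitive. *)
Lemma exact_on_step : exact_on (S :\: T) -> exact_on S.
Proof.
move=> exS' c cS dc.
have dS x : dA S x = dA (S :\: T) x + dA T x.
  rewrite -dAU; first by rewrite setUC setDE setUIr setUCr setIT (setUidPr TS).
  by rewrite -setI_eq0 setDE -setIA (setIC (~: T)) setICr setI0.
set p := hres c; have pS' : p \in _ := hres_supported cS.
have dp : dA S p = 0 by rewrite dA_hres dc hres0.
have dTsupp x : x \in esupp (fun H => H \subset S :\: T) ->
    dA T x \in esupp (fun H => (H \subset S) && (H :&: T != set0)).
  apply: dA_supported => H e; rewrite subsetD => /andP[HS _] eT.
  rewrite subUset sub1set HS (subsetP TS _ eT) /=; apply/set0Pn; exists e.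
  by rewrite !inE eqxx eT.
(* The part of the differential of [p] along [S :\: T] avoids [T] and the part along [T] meets it.
   Their supports are disjoint, so each part vanishes. *)
have dp' : dA (S :\: T) p = 0.
  have pW : p \in esupp (fun H => H \subset S :\: T) by apply: esuppW pS' => H /andP[].
  apply: (@esupp_disjoint (fun H => H \subset S :\: T)
            (fun H => (H \subset S) && (H :&: T != set0)) _ (dA T p)) => [H|||].
  - by rewrite subsetD -setI_eq0 => /andP[_ /eqP->]; rewrite eqxx andbF.
  - by apply: dA_supported pW => H e HS eS; rewrite subUset sub1set eS.
  - exact: dTsupp.
  by rewrite -dS.
have [b' b'S' db'] := exS' _ pS' dp'.
have b'S : b' \in esupp (fun H => H \subset S).
  by apply: esuppW b'S' => H /subset_trans; apply; exact: subsetDl.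
(* The differentials of [b'] along [S] and [S :\: T] differ by a chain on subgraphs meeting [T],
   which [hres] kills. *)
have dPb' : dA S (hres b') = hres p.
  have E a b : hres (a + b) = hres a + hres b by rewrite -[a]mulr1z hres_lin !mulr1z.
  by rewrite dA_hres dS E db' (hres_meet (dTsupp _ b'S')) addr0.
have cW : c \in esupp (fun H => H \subset S) by apply: esuppW cS => H /andP[].
have hresW x : x \in esupp (fun H => H \subset S) -> hres x \in esupp (fun H => H \subset S).
  by move=> xS; do 2?apply: esuppB => //;
    do ?[exact: h_supported|apply: dA_S_supported|apply: h_supported].
(* Up to the differentials of [h c] and [h p], the chain [c] equals [p] and [p] equals [hres p],
   which is the differential of [hres b']. *)
exists (h c + h p + hres b').
  by apply: esuppD; [apply: esuppD; apply: h_supported|] => //; exact: hresW.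
have E x y z : dA S (x + y + z) = dA S x + dA S y + dA S z by rewrite !raddfD.
have pE : hres p = p - dA S (h p) by rewrite {1}/hres dp raddf0 subr0.
have cE : p = c - dA S (h c) by rewrite /p /hres dc raddf0 subr0.
by rewrite E dPb' pE -addrA subrKC cE subrKC.
Qed.

End Homotopy.
End Exactness.

(** * Vertices with a single neighbour: moving their weight, and their existence *)

Section Pendant.
Variable G : multigraph.
Implicit Types (e f : edge G) (a b u v x y : vertex G) (H S : {set edge G}).
Implicit Types w : vertex G -> nat.

Definition move_weight a b w u : nat :=
  if u == b then 0%N else if u == a then (w a + w b)%N else w u.

Lemma sum_move_weight a b w (A : {set vertex G}) : a != b -> (a \in A) = (b \in A) ->
  (\sum_(u in A) move_weight a b w u = \sum_(u in A) w u)%N.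
Proof.
move=> ab aA; have [bA|bA] := boolP (b \in A); last first.
  apply: eq_bigr => u uA; rewrite /move_weight.
  case: eqP uA bA => [-> ->//|_ uA bA]; case: eqP uA => [->|//].
  by rewrite aA (negPf bA).
rewrite !(big_setD1 b bA) /= {1}/move_weight eqxx add0n.
have aD : a \in A :\ b by rewrite !inE ab aA bA.
rewrite !(big_setD1 a aD) /= {1}/move_weight (negPf ab) eqxx [RHS]addnCA addnA.
congr (_ + _)%N; apply: eq_bigr => u; rewrite !inE => /and3P[ua ub _].
by rewrite /move_weight (negPf ua) (negPf ub).
Qed.

Section Leaf.
Variables (S : {set edge G}) (a b : vertex G) (e1 : edge G).
Hypotheses (ab : a != b) (e1S : e1 \in S) (e1ab : joins e1 a b).
Hypothesis leaf : forall e u, e \in S -> joins e b u -> u = a.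
Local Notation sh := (move_weight a b).

(** Retracting [b] onto [a] sends each edge of [H] to a point or to an edge of [H :\ e1]. *)
Lemma connect_del_leaf H x y : H \subset S -> x != b -> y != b ->
  connect (adj (H :\ e1)) x y = connect (adj H) x y.
Proof.
move=> HS xb yb; apply/idP/idP; first by apply: connect_adjS; exact: subsetDl.
pose r u := if u == b then a else u.
have rE u : u != b -> r u = u by rewrite /r => /negPf->.
suff rP : connect (adj H) x y -> component (H :\ e1) (r x) = component (H :\ e1) (r y).
  by move=> /rP/eqP; rewrite component_eq !rE.
apply: (connect_invariant (f := fun u => component (H :\ e1) (r u))) => e u v eH euv.
have eS := subsetP HS _ eH.
case: (eqVneq u b) (euv) => [-> /(leaf eS) ->|ub _]; first by rewrite /r eqxx (negPf ab).
case: (eqVneq v b) (euv) => [->|vb _].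
  by rewrite joinsC => /(leaf eS) ->; rewrite /r eqxx (negPf ab).
apply/eqP; rewrite component_eq !rE //; apply: (connect_joins _ euv).
rewrite !inE eH andbT; apply: contraNneq vb => ee1.
move: euv; rewrite ee1 => /joins_inv/(_ e1ab)[[_ ->]//|[E _]].
by rewrite E eqxx in ub.
Qed.

Lemma csum_move H w e v : H \subset S -> e \in H -> e \in [set e in S | joins e a b] ->
  csum H (sh w) v = csum H w v.
Proof.
move=> HS eH; rewrite inE => /andP[eS eab]; apply: sum_move_weight => //.
rewrite !inE; apply: same_connect_r; first exact: connect_adj_sym.
exact: connect_joins eab.
Qed.

Lemma csum_del_leaf H w v : H \subset S -> e1 \in H -> v != b ->
  csum (H :\ e1) (sh w) v = csum H w v.
Proof.
move=> HS e1H vb; rewrite -(@csum_move H w e1) ?inE ?e1S // /csum.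
rewrite big_mkcond [RHS]big_mkcond; apply: eq_bigr => u _.
have [->|ub] := eqVneq u b; first by rewrite /move_weight eqxx !if_same.
by rewrite !inE connect_del_leaf.
Qed.

Lemma csum_del_leaf_eq H w w' v : H \subset S -> e1 \in H ->
  (forall v, csum H w v = csum H w' v) ->
  csum (H :\ e1) (sh w) v = csum (H :\ e1) (sh w') v.
Proof.
move=> HS e1H ww'; have [->|vb] := eqVneq v b; last by rewrite !csum_del_leaf.
(* At [b] itself, either a parallel edge still joins it to [a], or it has become isolated, with
   weight 0 after the move. *)
have [ba|ba] := boolP (connect (adj (H :\ e1)) b a).
  by rewrite !(csum_connect _ ba) !csum_del_leaf.
have iso e u : e \in H :\ e1 -> ~~ joins e b u.
  move=> eH; apply: contra ba => ebu; have eS : e \in S.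
    by apply: subsetP HS _ _; case/setD1P: eH.
  by rewrite -(leaf eS ebu); exact: connect_joins ebu.
by rewrite !csum_isolated // /move_weight eqxx.
Qed.

Lemma csum_del_leaf_ge H w v k : H \subset S -> e1 \in H -> (k <= csum H w v)%N ->
  exists v', (k <= csum (H :\ e1) (sh w) v')%N.
Proof.
move=> HS e1H kv; have [vb|vb] := eqVneq v b; last first.
  by exists v; rewrite csum_del_leaf.
exists a; rewrite csum_del_leaf // (csum_connect _ (_ : connect _ a b)) -?vb //.
by rewrite vb; exact: connect_joins e1ab.
Qed.

End Leaf.

(** Edges chosen between consecutive vertices are automatically distinct: if two different indices
    shared an edge, each would be the successor of the other modulo [k], impossible for [k] above
    2. *)
Lemma has_cycle_seq (f : nat -> vertex G) k : (2 < k)%N ->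
  (forall i j, (i < k)%N -> (j < k)%N -> f i = f j -> i = j) ->
  (forall i, (i.+1 < k)%N -> adj setT (f i) (f i.+1)) ->
  adj setT (f k.-1) (f 0%N) -> has_cycle G k.
Proof.
move=> k3 f_inj f_adj f_last.
have /choice[e eP] : forall i : 'I_k, exists e, joins e (f i) (f (ordS i)).
  move=> i /=; have [ik|] := ltnP i.+1 k.
    by rewrite modn_small //; have /adjP[e _ eP] := f_adj _ ik; exists e.
  move=> ki; have ik : i.+1 = k by apply/eqP; rewrite eqn_leq ki ltn_ord.
  rewrite ik modnn; have /adjP[e _ eP] := f_last; exists e.
  by rewrite (_ : nat_of_ord i = k.-1) //; lia.
exists (fun i => f i), e; split=> //.
  by move=> i j /f_inj ij; apply: val_inj; exact: ij.
move=> i j eij; have := eP j; rewrite -eij => /joins_inv/(_ (eP i)).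
case=> -[/f_inj E1 /f_inj E2]; first by apply/val_inj/esym/E1.
have := E1 (ltn_ord _) (ltn_ord _); have := E2 (ltn_ord _) (ltn_ord _).
move=> /= ji ij; move: (ltn_ord i) (ltn_ord j) ji ij k3.
move=> ik jk; have : (i.+1 %% k = if i.+1 == k then 0 else i.+1)%N.
  by case: eqP => [->|?]; [rewrite modnn|rewrite modn_small //; lia].
have : (j.+1 %% k = if j.+1 == k then 0 else j.+1)%N.
  by case: eqP => [->|?]; [rewrite modnn|rewrite modn_small //; lia].
by move=> -> ->; case: eqP; case: eqP => *; lia.
Qed.

(** The starting vertex of a longest simple path in [S] works: a neighbour off the path would extend
    it, and a neighbour on the path beyond the second vertex would close a cycle of length at least
    3. *)
Lemma exists_leaf S : loopless G -> (forall k, (2 < k)%N -> ~ has_cycle G k) ->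
  S != set0 -> exists a b e1, [/\ a != b, e1 \in S, joins e1 a b &
    forall e u, e \in S -> joins e b u -> u = a].
Proof.
move=> nl nc /set0Pn[e0 e0S].
have joins_neq e u v : joins e u v -> u != v.
  move=> /joins_inv/(_ (joins_ends e)) H; apply/eqP => uv; apply: (nl e).
  by case: H => -[<- <-].
pose P n := `[< exists x p, [/\ size p = n, path (adj S) x p & uniq (x :: p)] >].
have P1 : P 1%N.
  apply/asboolP; exists (ends e0).1, [:: (ends e0).2]; split=> //=.
    by rewrite andbT; apply/adjP; exists e0 => //; exact: joins_ends.
  by rewrite inE (joins_neq e0) // joins_ends.
have Pub n : P n -> (n <= #|vertex G|)%N.
  move=> /asboolP[x [p [<- _ /card_uniqP up]]].
  by apply: ltnW; rewrite -[(size p).+1]/(size (x :: p)) -up max_card.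
case: (ex_maxnP (ex_intro P 1%N P1) Pub) => n /asboolP[y [[|z q] [sp pp up]]] nmax.
  by have := nmax _ P1; rewrite -sp.
case/andP: (pp) => /adjP[e1 e1S yz] pq.
exists z, y, e1; split=> //; [by rewrite eq_sym (joins_neq e1)|by rewrite joinsC|].
move=> e u eS yu; apply/eqP; apply: contraT => uz.
have yu' := joins_neq _ _ _ yu.
have uin : u \in y :: z :: q.
  apply: contraT => uN; have : P n.+1; last by move/nmax; rewrite ltnn.
  apply/asboolP; exists u, (y :: z :: q); split; first by rewrite -sp.
    by apply/andP; split; [apply/adjP; exists e; rewrite // joinsC|exact: pp].
  by rewrite cons_uniq uN.
(* The initial segment of the path up to [u], closed by [e], is a cycle on [k.+1] vertices. *)
pose s := y :: z :: q; pose k := index u s; pose f i := nth y s i.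
have ks : (k < size s)%N by rewrite index_mem.
have k2 : (1 < k)%N.
  by rewrite /k /s /= (negPf yu') eq_sym (negPf uz).
case: (nc k.+1 k2); apply: (has_cycle_seq (f := f)) => //.
- move=> i j ik jk /eqP; rewrite nth_uniq // ?(leq_trans ik) ?(leq_trans jk) //.
  by move/eqP.
- move=> i ik; have iq : (i < size (z :: q))%N by move: ks; rewrite /s /=; lia.
  by have /adjP[f' _ f'j] := pathP y pp i iq; apply/adjP; exists f'; rewrite ?inE.
rewrite /= /f nth_index //; apply/adjP; exists e; first by rewrite inE.
by rewrite joinsC.
Qed.

End Pendant.

(** * Exactness for graphs with a loop and for graphs without long cycles *)

Section ExactTotal.
Variables (G : multigraph) (leE : rel (edge G)) (m' : nat).
Hypotheses (leE_total : total leE) (leE_anti : antisymmetric leE).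

(** Deleting a loop changes no component, so no weight has to be moved; taking all edges for [T]
    leaves only the empty edge set. *)
Lemma exact_on_loop (e : edge G) : (ends e).1 = (ends e).2 -> exact_on leE m' setT.
Proof.
move=> le; have csum_del (H : {set edge G}) w v : e \in H -> csum (H :\ e) w v = csum H w v.
  by move=> eH; rewrite -[in RHS](setD1K eH) csum_add /= le eqxx.
apply: (@exact_on_step _ _ _ leE_total leE_anti setT setT e id) => //.
- by move=> H w w' _ eH ww' v; rewrite !csum_del.
- by move=> H w v _ eH ov; exists v; rewrite csum_del.
by rewrite setDv; exact: exact_on0.
Qed.

(** Induction on the number of edges, removing at each step the whole class of parallel edges at a
    vertex with one neighbour. *)
Lemma exact_on_forest (S : {set edge G}) : loopless G ->
  (forall k, (2 < k)%N -> ~ has_cycle G k) -> exact_on leE m' S.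
Proof.
move=> nl nc; have [n] := ubnP #|S|; elim: n S => // n IH S; rewrite ltnS => Sn.
have [->|S0] := eqVneq S set0; first exact: exact_on0.
have [a [b [e1 [ab e1S e1ab leaf]]]] := exists_leaf nl nc S0.
pose T := [set e in S | joins e a b].
have TS : T \subset S by apply/subsetP => e; rewrite inE => /andP[].
have e1T : e1 \in T by rewrite inE e1S.
apply: (@exact_on_step _ _ _ leE_total leE_anti S T e1 (move_weight a b)) => //.
- by move=> H w e HS eH eT v; apply: (@csum_move G S a b _ H w e).
- by move=> H w w' HS e1H ww' v; apply: (@csum_del_leaf_eq G S a b e1).
- by move=> H w v HS e1H; apply: (@csum_del_leaf_ge G S a b e1).
apply: IH; apply: leq_trans Sn; apply: proper_card; apply/properP; split.
  exact: subsetDl.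
by exists e1; rewrite // !inE e1S e1ab.
Qed.

End ExactTotal.

(** * Classes in a quotient group and their multiples *)

Section QuotientZmodule.
Local Open Scope quotient_scope.
Variables (R : zmodType) (I : zmodClosed R).
Local Notation Q := (Quotient.quot I).

Lemma quot_pi_onto (a : Q) : exists x : R, a = \pi_Q x.
Proof. by exists (repr a); rewrite reprK. Qed.

Lemma quot_pi_eq0 (x : R) : (\pi_Q x = 0 :> Q) <-> (x \in I).
Proof.
rewrite -[x in x \in _]subr0 Quotient.idealrBE; split=> [E|/eqP E].
  by apply/eqP; rewrite E piE.
by rewrite E piE.
Qed.

Lemma quot_piMn (x : R) n : (\pi_Q x) *+ n = \pi_Q (x *+ n).
Proof.
elim: n => [|n IH]; first by rewrite !mulr0n piE.
by rewrite !mulrS IH piE.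
Qed.

End QuotientZmodule.

(** * Orders of elements and torsion of direct sums *)

Section DirectSumTorsion.

Lemma has_order_dvd (A : zmodType) (a : A) k : (0 < k)%N -> a *+ k = 0 ->
  exists2 n, has_order a n & (n %| k)%N.
Proof.
move=> k0 ak; have ex : exists n, (0 < n)%N && (a *+ n == 0) by exists k; rewrite k0 ak eqxx.
case: (ex_minnP ex) => n /andP[n0 /eqP an] nmin; exists n.
  split=> // j /andP[j0 jn] aj; have := nmin j; rewrite j0 aj eqxx => /(_ isT).
  by rewrite leqNgt jn.
rewrite /dvdn; case: (posnP (k %% n)) => [_ //|r0].
have := nmin (k %% n)%N; rewrite r0 leqNgt ltn_pmod //=.
suff -> : a *+ (k %% n) = 0 by rewrite eqxx => /(_ isT).
by move: ak; rewrite {1}(divn_eq k n) mulrnDr mulnC mulrnA an mul0rn add0r.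
Qed.

Variables (I : eqType) (A : I -> zmodType).

Lemma dsum_valMn (a : dsum A) n i : dsum_val (a *+ n) i = dsum_val a i *+ n.
Proof. by elim: n => [|n IH]; rewrite ?mulr0n // !mulrS -IH. Qed.

Lemma dsum_eq0 (a : dsum A) : (forall i, dsum_val a i = 0) -> a = 0.
Proof. by move=> a0; apply: val_inj; apply: functional_extensionality_dep => i; exact: a0. Qed.

(** The cast is there because [A j] varies with [j]; at [j = i] it is trivial, since equality proofs
    on an [eqType] are unique. *)
Definition single i (x : A i) : dep_prod A :=
  fun j => if i =P j is ReflectT E then eq_rect i (fun k => A k : Type) x j E else 0.

Lemma single_finitely_supported i (x : A i) : single x \in @finitely_supported I A.
Proof.
apply/asboolP; exists [:: i] => j; rewrite inE /single => /eqP ji.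
by case: eqP => // E; case: ji.
Qed.

Lemma single_id i (x : A i) : single x i = x.
Proof. by rewrite /single; case: eqP => // E; rewrite (eq_axiomK E). Qed.

Lemma single_neq i (x : A i) j : j != i -> single x j = 0.
Proof. by rewrite /single => /eqP ji; case: eqP => // E; case: ji. Qed.

Lemma dsum_torsion : has_torsion (dsum A) ->
  exists i (x : A i) k, [/\ x <> 0, (0 < k)%N & x *+ k = 0].
Proof.
case=> a [n [a0 [n0 an _]]]; apply: contrapT => N; apply: a0; apply: dsum_eq0 => i.
apply: contrapT => ai; apply: N; exists i, (dsum_val a i), n; split=> //.
by rewrite -dsum_valMn an.
Qed.

Lemma dsum_torsion_dividing i (x : A i) k :
  x <> 0 -> (0 < k)%N -> x *+ k = 0 -> has_torsion_dividing (dsum A) k.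
Proof.
move=> x0 k0 xk; pose a : dsum A := Dsum (single_finitely_supported x).
have ak : a *+ k = 0.
  apply: dsum_eq0 => j; rewrite dsum_valMn /=.
  have [->|ji] := eqVneq j i; first by rewrite single_id.
  by rewrite single_neq // mul0rn.
have [n an nk] := has_order_dvd k0 ak; exists a, n; split=> // a0; apply: x0.
by rewrite -(single_id x) -[single x]/(dsum_val a) a0.
Qed.

End DirectSumTorsion.

(** * From statements on chains to torsion in the bigraded homology *)

Section Bidegrees.
Local Open Scope quotient_scope.
Variables (G : multigraph) (leE : rel (edge G)) (m' : nat).
Hypotheses (leE_total : total leE) (leE_anti : antisymmetric leE).
Local Notation m := m'.+1.
Local Notation chain := {ffun state G m -> int}.
Implicit Types (s t : state G m) (b c y z : chain) (ij : nat * nat).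

Definition proj ij c : chain := [ffun s => if in_bidegree ij s then c s else 0].

Lemma proj_supported ij c : proj ij c \in supported (in_bidegree ij).
Proof. by apply/forallP => s; apply/implyP; rewrite ffunE; case: ifP; rewrite ?eqxx. Qed.

Lemma proj_id ij c : c \in supported (in_bidegree ij) -> proj ij c = c.
Proof.
move=> /forallP cP; apply/ffunP => s; rewrite ffunE; case: ifP => // /negbT sN.
by apply/esym/eqP; apply: contraNT sN; exact: implyP (cP s).
Qed.

Lemma diff_bidegree s t : diff_state leE s t != 0 ->
  height t = (height s).+1 /\ qdeg t = qdeg s.
Proof.
rewrite /diff_state => N.
suff [e es] : exists2 e, e \notin edges s & mono m' (e |: edges s) (wt s) t != 0.
  move=> tN; have [tE _] := mono_supp tN; rewrite /height tE cardsU1 es.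
  by rewrite (qdeg_mono tN) qdeg_total.
apply: contrapT => nE; case/eqP: N; rewrite sum_ffunE big1 // => e es.
rewrite -mulrz_suml sum_adds chainMzE.
have [->|tN] := eqVneq (mono m' (e |: edges s) (wt s) t) 0; first by rewrite mul0r.
by case: nE; exists e.
Qed.

Lemma diff_proj i j c : diff leE (proj (i, j) c) = proj (i.+1, j) (diff leE c).
Proof.
apply/ffunP => t; rewrite /diff ffunE !sum_ffunE.
have E (x : bool) (F : state G m -> int) :
  (if x then \sum_s F s else 0) = \sum_s (if x then F s else 0) by case: x => //; rewrite big1.
rewrite E; apply: eq_bigr => s _; rewrite !chainMzE ffunE.
have [->|/diff_bidegree[ht qt]] := eqVneq (diff_state leE s t) 0.
  by rewrite !mul0r if_same.
rewrite /in_bidegree ht qt !xpair_eqE eqSS.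
by case: ifP => _; rewrite ?mulr0.
Qed.

Lemma proj0_diff j c : proj (0%N, j) (diff leE c) = 0.
Proof.
apply/ffunP => t; rewrite !ffunE /in_bidegree xpair_eqE; case: ifP => // /andP[/eqP t0 _].
rewrite /diff sum_ffunE big1 // => s _; rewrite chainMzE.
have [->|/diff_bidegree[]] := eqVneq (diff_state leE s t) 0; first by rewrite mul0r.
by rewrite t0.
Qed.

Lemma proj_sum c :
  c = \sum_(ij <- undup [seq (height s, qdeg s) | s : state G m]) proj ij c.
Proof.
apply/ffunP => s; rewrite sum_ffunE.
rewrite (eq_bigr (fun ij => if ij == (height s, qdeg s) then c s else 0)) => [|ij _].
  rewrite -big_mkcond -big_filter filter_pred1_uniq ?undup_uniq ?big_seq1 //.
  by rewrite mem_undup; apply/codomP; exists s.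
by rewrite ffunE /in_bidegree eq_sym.
Qed.

(** In positive height every cocycle is a boundary; in height 0 there are no nonzero boundaries, so
    homology is a subgroup of a free group. *)
Lemma exact_torsion_free :
  (forall c, (forall s, c s != 0 -> edges s != set0) -> diff leE c = 0 ->
     exists b, diff leE b = c) ->
  ~ has_torsion (chromatic_homology leE m).
Proof.
move=> ex /dsum_torsion[[i j] [a [k [a0 k0 ak]]]].
have [z az] := quot_pi_onto a; case: a0; rewrite az; apply/quot_pi_eq0/asboolP.
move: ak; rewrite az quot_piMn => /quot_pi_eq0/asboolP[b bP db].
have /andP[zP /eqP dz] := valP z.
have vMn n : cocycle_val (z *+ n) = cocycle_val z *+ n.
  by elim: n => [|n IH]; rewrite ?mulr0n // !mulrS -IH.
(* In height 0 no state has the preceding bidegree, so [b] is zero and [k] times [z] vanishes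
   already as a chain. *)
case: i => [|i] in a z az zP dz b bP db vMn *.
  exists 0; first exact: rpred0.
  have b0 : b = 0.
    apply/ffunP => s; rewrite ffunE; apply/eqP; move/forallP: bP => /(_ s).
    by apply: contraTT => ->; rewrite /in_prev_bidegree xpair_eqE.
  move: db; rewrite b0 !raddf0 vMn => /esym/(chain_torsion_free k0).
  by move=> ->.
have zs s : cocycle_val z s != 0 -> edges s != set0.
  move/forallP: zP => /(_ s)/implyP zs /zs; rewrite /in_bidegree xpair_eqE.
  by case/andP => /eqP hs _; rewrite -card_gt0 -/(height s) hs.
have [b' db'] := ex _ zs dz.
(* The primitive [b'] need not be homogeneous, but its component in the preceding bidegree already
   maps to [z]. *)
exists (proj (i, j) b'); last by rewrite diff_proj db' proj_id.
apply/forallP => s; apply/implyP; rewrite ffunE /in_bidegree /in_prev_bidegree !xpair_eqE eqSS.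
by case: ifP; rewrite ?eqxx.
Qed.

(** [z] is a cocycle because [m] times its differential is zero. Some homogeneous component has
    nonzero [phi], so it is not a boundary, while [m] times it is one. *)
Lemma functional_torsion (U : zmodType) (phi : {additive chain -> U}) y z :
  (forall c, phi (diff leE c) = 0) -> diff leE y = z *+ m -> phi z != 0 ->
  has_torsion_dividing (chromatic_homology leE m) m.
Proof.
move=> phid dy phz; have m0 : (0 < m)%N by [].
have dd c : diff leE (diff leE c) = 0 by rewrite !diff_dA; exact: dA_sqr.
have dz : diff leE z = 0.
  by apply: (chain_torsion_free m0); rewrite -(raddfMn (@diff G leE m)) /= -dy; exact: dd.
have projMn ij c n : proj ij (c *+ n) = proj ij c *+ n.
  by apply/ffunP => s; rewrite ffunMnE !ffunE ffunMnE; case: ifP; rewrite ?mul0rn.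
have [ij phij] : exists ij, phi (proj ij z) != 0.
  apply: contrapT => N; case/eqP: phz; rewrite (proj_sum z) raddf_sum big1 // => ij _.
  by apply/eqP; apply: contrapT => /negP ?; apply: N; exists ij.
have zc : proj ij z \in is_cocycle leE ij.
  rewrite inE proj_supported; case: (ij) => i j; rewrite diff_proj dz.
  by apply/eqP/ffunP => s; rewrite !ffunE if_same.
pose zz := Cocycle zc; have vMn n : cocycle_val (zz *+ n) = proj ij z *+ n.
  by elim: n => [|n IH]; rewrite ?mulr0n // !mulrS -IH.
pose x : homology leE m ij := \pi zz.
apply: (@dsum_torsion_dividing _ _ ij x) => //.
  move=> /quot_pi_eq0/asboolP[b _ db]; case/eqP: phij.
  by rewrite -[proj ij z]/(cocycle_val zz) -db phid.
rewrite /x quot_piMn; apply/quot_pi_eq0/asboolP.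
(* Height 0 cannot occur: boundaries have no component there, so [z] would have none either. *)
case: ij => [[|i] j] in phij zc zz vMn x *.
  case/eqP: phij; rewrite (_ : proj _ _ = 0) ?raddf0 //.
  by apply: (chain_torsion_free m0); rewrite -projMn -dy proj0_diff.
exists (proj (i, j) y); last by rewrite diff_proj dy projMn vMn.
apply/forallP => s; apply/implyP; rewrite ffunE /in_bidegree /in_prev_bidegree !xpair_eqE eqSS.
by case: ifP; rewrite ?eqxx.
Qed.

End Bidegrees.

(** * A functional modulo m that vanishes on boundaries, built from a cycle *)

Section CycleFunctional.
Variables (G : multigraph) (leE : rel (edge G)) (m'' : nat).
Hypotheses (leE_total : total leE) (leE_anti : antisymmetric leE).
Local Notation m' := m''.+1.
Local Notation m := m'.+1.
Local Notation chain := {ffun state G m -> int}.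
Local Notation mono := (@mono G m').
Local Notation sgn := (sgn leE).
Local Notation d1 := (@d1 G leE m').
Local Notation dA := (@dA G leE m').
Implicit Types (e f : edge G) (u v : vertex G) (H A B S T : {set edge G}).
Implicit Types w : vertex G -> nat.

Variables (n : nat) (vv : nat -> vertex G) (ee : nat -> edge G).
Hypothesis n3 : (2 < n)%N.
Hypothesis vv_inj : forall i j, (i < n)%N -> (j < n)%N -> vv i = vv j -> i = j.
Hypothesis ee_inj : forall i j, (i < n)%N -> (j < n)%N -> ee i = ee j -> i = j.
Hypothesis eeP : forall i, (i < n)%N -> joins (ee i) (vv i) (vv (i.+1 %% n)).

Definition cyc : {set edge G} := [set ee (val i) | i : 'I_n].
Definition on_cyc v := [exists i : 'I_n, v == vv i].
Definition cyc2 i j := cyc :\ ee i :\ ee j.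

Lemma cycP e : reflect (exists2 i, (i < n)%N & e = ee i) (e \in cyc).
Proof.
apply: (iffP imsetP) => [[i _ ->]|[i ilt ->]]; first by exists i.
by exists (Ordinal ilt).
Qed.

Lemma on_cycP v : reflect (exists2 i, (i < n)%N & v = vv i) (on_cyc v).
Proof.
apply: (iffP existsP) => [[i /eqP->]|[i ilt ->]]; first by exists i.
by exists (Ordinal ilt).
Qed.

Lemma cyc2P i j e : reflect (exists k, [/\ (k < n)%N, ee k != ee i, ee k != ee j & e = ee k])
  (e \in cyc2 i j).
Proof.
apply: (iffP setD1P) => [[ej /setD1P[ei /cycP[k kn E]]]|[k [kn ki kj ->]]].
  by exists k; rewrite -E.
by split=> //; apply/setD1P; split=> //; apply/cycP; exists k.
Qed.

Lemma ee_neq i j : (i < n)%N -> (j < n)%N -> i != j -> ee i != ee j.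
Proof. by move=> ilt jlt; apply: contraNneq => /(ee_inj ilt jlt) ->. Qed.

Lemma joins_off_cyc e u v : e \in cyc -> joins e u v -> on_cyc u.
Proof.
move=> /cycP[k kn ->] /joins_inv/(_ (eeP kn)).
have kn' : (k.+1 %% n < n)%N by rewrite ltn_pmod //; lia.
by case=> -[-> _]; apply/on_cycP; [exists k|exists (k.+1 %% n)%N].
Qed.

Section TwoArcs.
Variables i j : nat.
Hypotheses (ij : (i < j)%N) (jn : (j < n)%N).

(** The edge [ee k] leaves [vv k] upwards, so without [ee i] and [ee j] one arc runs from [vv i.+1]
    to [vv j]; the other one passes through [vv 0]. *)
Definition in_arc l := (i < l <= j)%N.

Lemma connect_up l k : (l <= k < n)%N ->
  (forall r, (l <= r < k)%N -> (r != i) && (r != j)) ->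
  connect (adj (cyc2 i j)) (vv l) (vv k).
Proof.
elim: k => [|k IH] /andP[lk kn] rP; first by move: lk; rewrite leqn0 => /eqP->.
have [->|lk1] := eqVneq l k.+1; first exact: connect0.
have lk' : (l <= k)%N by lia.
apply: connect_trans (IH _ _) _; first by rewrite lk' ltnW.
  by move=> r rk; apply: rP; lia.
have /andP[ki kj] := rP k ltac:(lia).
apply: (@connect_joins _ _ (ee k)).
  by apply/cyc2P; exists k; split=> //; rewrite ?ee_neq //; lia.
by have := eeP (ltnW kn); rewrite modn_small.
Qed.

Lemma arc_invariant u v : connect (adj (cyc2 i j)) u v ->
  [exists l : 'I_n, in_arc l && (u == vv l)] = [exists l : 'I_n, in_arc l && (v == vv l)].
Proof.
pose f u := [exists l : 'I_n, in_arc l && (u == vv l)].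
apply: (connect_invariant (f := f)) => e x y /cyc2P[k [kn ki kj ->]].
have fE l : (l < n)%N -> f (vv l) = in_arc l.
  move=> ln; apply/existsP/idP => [[r /andP[ra /eqP /vv_inj E]]|la].
    by rewrite (E ln (ltn_ord r)).
  by exists (Ordinal ln); rewrite /= la eqxx.
suff fk : f (vv k) = f (vv (k.+1 %% n)).
  by move=> /joins_inv/(_ (eeP kn))[] [-> ->].
have {}ki : k != i by apply: contraNneq ki => ->.
have {}kj : k != j by apply: contraNneq kj => ->.
have [k1n|nk] := ltnP k.+1 n.
  rewrite modn_small // !fE // /in_arc; lia.
have -> : k.+1 = n by lia.
rewrite modnn !fE ?/in_arc; lia.
Qed.

Lemma connect_arc l : (l < n)%N ->
  connect (adj (cyc2 i j)) (vv (if in_arc l then j else i)) (vv l).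
Proof.
move=> ln; rewrite connect_adj_sym; case: ifP; rewrite /in_arc => la.
  by apply: connect_up => [|r rr]; lia.
have [li|il] := leqP l i; first by apply: connect_up => [|r rr]; lia.
(* Beyond [j] the other arc wraps around: up to the last vertex, across [ee n.-1] to [vv 0], and up
   to [vv i]. *)
apply: (@connect_trans _ _ (vv n.-1)); first by apply: connect_up => [|r rr]; lia.
apply: (@connect_trans _ _ (vv 0%N)); last by apply: connect_up => [|r rr]; lia.
apply: (@connect_joins _ _ (ee n.-1)).
  by apply/cyc2P; exists n.-1; split=> //; rewrite ?ee_neq //; lia.
have := eeP (_ : n.-1 < n)%N; rewrite (_ : n.-1.+1 = n) ?modnn; last by lia.
by apply; lia.
Qed.

Lemma connect_arcE l u : (l < n)%N -> connect (adj (cyc2 i j)) (vv l) u =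
  [exists k : 'I_n, (in_arc k == in_arc l) && (u == vv k)].
Proof.
move=> ln; apply/idP/existsP => [lu|[k /andP[/eqP kl /eqP->]]]; last first.
  apply: connect_trans (connect_arc (ltn_ord k)); rewrite kl connect_adj_sym.
  exact: connect_arc.
have /on_cycP[k kn uk] : on_cyc u.
  have := connect_invariant (f := on_cyc) _ lu; move=> <-; last first.
    move=> e x y /cyc2P[r [rn _ _ ->]] rxy; apply: etrans (_ : true = _); last apply: esym.
      by apply: joins_off_cyc rxy; apply/cycP; exists r.
    by apply: joins_off_cyc (_ : joins _ _ x); [apply/cycP; exists r|rewrite joinsC].
  by apply/on_cycP; exists l.
exists (Ordinal kn); rewrite -uk eqxx andbT /=.
have fE r : (r < n)%N -> [exists l : 'I_n, in_arc l && (vv r == vv l)] = in_arc r.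
  move=> rn; apply/existsP/idP => [[t /andP[ra /eqP /vv_inj E]]|la].
    by rewrite (E rn (ltn_ord t)).
  by exists (Ordinal rn); rewrite /= la eqxx.
by have := arc_invariant lu; rewrite uk !fE // => ->.
Qed.

Lemma csum_arc w l : (l < n)%N ->
  csum (cyc2 i j) w (vv l) = (\sum_(k < n | in_arc k == in_arc l) w (vv k))%N.
Proof.
move=> ln; have vv_ord : injective (fun k : 'I_n => vv k).
  by move=> a b /vv_inj E; apply: val_inj; exact: E.
rewrite /csum -(big_imset w (h := fun k : 'I_n => vv k)) /=; last first.
  by move=> a b _ _ /vv_ord.
apply: eq_bigl => u; rewrite inE connect_arcE //.
apply/existsP/imsetP => [[k /andP[kl /eqP->]]|[k kl ->]]; exists k => //.
by rewrite eqxx andbT; exact: kl.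
Qed.

End TwoArcs.

Definition cyc_total w := (\sum_(k < n) w (vv k))%N.
(** A potential along the cycle: its increment from [i] to [j] is the weight of the arc after [vv i]
    up to [vv j]. *)
Definition partial_sum w l : int := \sum_(k < n | (k <= l)%N) (w (vv k))%:Z.


Lemma csum_arc_total w i j : (i < j)%N -> (j < n)%N ->
  (csum (cyc2 i j) w (vv i) + csum (cyc2 i j) w (vv j) = cyc_total w)%N.
Proof.
move=> ij jn; have ilt := ltn_trans ij jn.
have ai : in_arc i j i = false by rewrite /in_arc; lia.
have aj : in_arc i j j by rewrite /in_arc; lia.
rewrite !csum_arc // ai aj /cyc_total addnC [RHS](bigID (fun k : 'I_n => in_arc i j k)) /=.
by congr (_ + _)%N; apply: eq_bigl => k; case: (in_arc _ _ _).
Qed.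

Lemma csum_arc_partial w i j : (i < j)%N -> (j < n)%N ->
  partial_sum w j - partial_sum w i = (csum (cyc2 i j) w (vv j))%:Z.
Proof.
move=> ij jn; have aj : in_arc i j j by rewrite /in_arc; lia.
rewrite csum_arc // aj /partial_sum.
rewrite (bigID (fun k : 'I_n => (k <= i)%N)) /= [X in X + _ - _](_ : _ = partial_sum w i).
  rewrite addrC addKr -(big_morph Posz PoszD (erefl _)); congr Posz.
  by apply: eq_bigl => k; rewrite /in_arc; lia.
by apply: eq_bigl => k; lia.
Qed.

(* The coefficient at C of (sum_j g_j e_j) ^ delta ^ H in the exterior algebra on
   the edges, where delta is the sum of all edges; it kills differentials because
   delta ^ delta = 0. *)
Definition psi (g : nat -> int) H : int :=
  \sum_(j < n) \sum_(e | [&& e \notin H, ee j \notin e |: H & ee j |: (e |: H) == cyc])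
    g j * (sgn H e * sgn (e |: H) (ee j)).

Lemma psi_neq0 g H : psi g H != 0 -> exists i j, [/\ (i < j)%N, (j < n)%N & H = cyc2 i j].
Proof.
move=> N; have [j [e /and3P[eH jH /eqP E]]] : exists (j : 'I_n) e,
    [&& e \notin H, ee j \notin e |: H & ee j |: (e |: H) == cyc].
  apply: contrapT => nE; case/eqP: N; rewrite /psi big1 // => j _; rewrite big1 // => e eP.
  by case: nE; exists j, e.
have /cycP[i ilt ei] : e \in cyc by rewrite -E !inE eqxx orbT.
have HE : H = cyc2 j i.
  by rewrite /cyc2 -E setU1K // -ei setU1K.
have HE' : H = cyc2 i j by rewrite HE /cyc2 !setDDl setUC.
have : i != j by apply: contraNneq jH => <-; rewrite ei !inE eqxx.
rewrite neq_ltn => /orP[ltij|ltji]; first by exists i, j.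
by exists j, i.
Qed.

(** The missing edges can be added back in two orders, with opposite signs by [sgn_swap]; the last
    edge added contributes its value of [g]. *)
Lemma psi_cyc2 i j : (i < j)%N -> (j < n)%N ->
  exists2 s : int, s * s = 1 & forall g, psi g (cyc2 i j) = (g j - g i) * s.
Proof.
move=> ij jn; have ilt := ltn_trans ij jn; pose H := cyc2 i j; rewrite -/H.
have neij : ee i != ee j by rewrite ee_neq //; lia.
have iH : ee i \notin H by rewrite !inE eqxx andbF.
have jH : ee j \notin H by rewrite !inE eqxx.
have iC : ee i \in cyc by apply/cycP; exists i.
have jC : ee j \in cyc by apply/cycP; exists j.
have CE : ee j |: (ee i |: H) = cyc.
  rewrite setUCA setD1K ?setD1K //.
  by rewrite !inE eq_sym neij jC.
exists (sgn H (ee i) * sgn (ee i |: H) (ee j)).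
  by rewrite mulrACA !sgn_sqr mulr1.
move=> g; rewrite /psi (bigD1 (Ordinal jn)) // (bigD1 (Ordinal ilt)) /=; last first.
  by rewrite -val_eqE /=; lia.
rewrite (big_pred1 (ee i)) => [|e]; last first.
  apply/and3P/eqP => [[_ _ /eqP E]|->]; last first.
    by rewrite iH in_setU1 negb_or eq_sym neij jH CE.
  have : ee i \in ee j |: (e |: H) by rewrite E.
  by rewrite !in_setU1 (negPf neij) (negPf iH) orbF => /eqP.
rewrite (big_pred1 (ee j)) => [|e]; last first.
  apply/and3P/eqP => [[_ _ /eqP E]|->]; last first.
    by rewrite jH in_setU1 negb_or neij iH setUCA CE.
  have : ee j \in ee i |: (e |: H) by rewrite E.
  by rewrite !in_setU1 eq_sym (negPf neij) (negPf jH) orbF => /eqP.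
rewrite [X in _ + (_ + X)]big1 => [|k /andP[kj ki]]; last first.
  rewrite big_pred0 // => e; apply: negbTE; rewrite !negb_and !negbK.
  suff -> : ee k \in e |: H by rewrite orbT.
  rewrite inE; apply/orP; right; apply/cyc2P; exists k.
  by split=> //; rewrite ?ee_neq //.
rewrite addr0 (sgn_swap leE_total leE_anti jH iH) 1?eq_sym // mulrN.
by rewrite mulrBl.
Qed.

Lemma psi_differential g H : \sum_(f | f \notin H) psi g (f |: H) * sgn H f = 0.
Proof.
pose F (j : 'I_n) e f : int :=
  if [&& f \notin H, e \notin f |: H, ee j \notin e |: (f |: H) &
      ee j |: (e |: (f |: H)) == cyc]
  then g j * (sgn H f * sgn (f |: H) e * sgn (e |: (f |: H)) (ee j)) else 0.
have -> : \sum_(f | f \notin H) psi g (f |: H) * sgn H f =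
    \sum_(j < n) \sum_f \sum_e F j e f.
  rewrite [RHS]exchange_big /= big_mkcond; apply: eq_bigr => f _; rewrite /psi.
  case: ifP => fH; last by rewrite big1 // => j _; rewrite big1 // => e _; rewrite /F fH.
  rewrite mulr_suml; apply: eq_bigr => j _; rewrite mulr_suml big_mkcond.
  apply: eq_bigr => e _; rewrite /F fH /=; case: ifP => // _.
  by rewrite mulrAC -!mulrA; congr (_ * _); rewrite mulrA mulrC mulrA.
rewrite big1 // => j _; set X := \sum_f _.
(* Exchanging [e] and [f] flips the sign of every summand, which is the vanishing of delta ^
   delta. *)
suff XN : X = - X by lia.
rewrite {1}/X exchange_big -sumrN; apply: eq_bigr => e _; rewrite -sumrN.
apply: eq_bigr => f _; rewrite /F.
have [->|ef] := eqVneq e f; first by rewrite !in_setU1 eqxx /= !andbF oppr0.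
rewrite (@in_setU1 _ e f) (@in_setU1 _ f e) (eq_sym f e) (negPf ef) /= (setUCA [set f]).
case eH: (e \in H); case fH: (f \in H); rewrite /= ?oppr0 //.
case: ifP => _; rewrite ?oppr0 // -mulrN -mulNr; congr (_ * (_ * _)).
by rewrite sgn_swap ?eH ?fH // eq_sym.
Qed.

(** With [psi] applied to the partial sums, the value is, up to sign, the exponent of one arc. Total
    weight [m] on the cycle is what makes it compatible with x^m = 0. *)
Definition Phi H w : 'Z_m :=
  if (cyc_total w == m) && [forall v, on_cyc v || (w v == m')]
  then (psi (partial_sum w) H)%:~R else 0.

Lemma Phi_cyc2 i j w : (i < j)%N -> (j < n)%N ->
  exists2 s : int, s * s = 1 & Phi (cyc2 i j) w =
  if (cyc_total w == m) && [forall v, on_cyc v || (w v == m')]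
  then ((csum (cyc2 i j) w (vv j))%:Z * s)%:~R else 0.
Proof.
move=> ij jn; have [s ss psiE] := psi_cyc2 ij jn; exists s => //.
by rewrite /Phi psiE csum_arc_partial.
Qed.

Lemma csum_off i j w v : ~~ on_cyc v -> csum (cyc2 i j) w v = w v.
Proof.
move=> vN; apply: csum_isolated => e u /cyc2P[k [kn _ _ ->]]; apply: contra vN.
by apply: joins_off_cyc; apply/cycP; exists k.
Qed.

(** The condition on [w] is read off the labels: the two arcs add up to the cycle total, and
    vertices off the cycle are isolated. *)
Lemma Phi_invariant H : label_invariant m' Phi H.
Proof.
have [[i [j [ij jn ->]]]|NH] := pselect (exists i j, [/\ (i < j)%N, (j < n)%N & H = cyc2 i j]);
    last first.
  have p0 g : psi g H = 0 by apply/eqP; apply: contra_notT NH; exact: psi_neq0.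
  by split=> *; rewrite /Phi !p0 !if_same.
have [s ss psiE] := psi_cyc2 ij jn.
have PE w : Phi (cyc2 i j) w =
    if (cyc_total w == m) && [forall v, on_cyc v || (w v == m')]
    then ((csum (cyc2 i j) w (vv j))%:Z * s)%:~R else 0.
  by rewrite /Phi psiE csum_arc_partial.
split=> [w w' ww'|w v over]; rewrite !PE.
  rewrite -!(csum_arc_total _ ij jn) !ww'; congr (if _ && _ then _ else _).
  apply: eq_forallb => v; case: (boolP (on_cyc v)) => //= vN.
  by rewrite -(csum_off i j w vN) -(csum_off i j w' vN) ww'.
case: ifP => // /andP[/eqP T /forallP off].
have /on_cycP[l ln vl] : on_cyc v.
  apply: contraLR over => vN; have := off v; rewrite csum_off // (negPf vN) /= => /eqP->.
  by rewrite ltnn.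
have m0 : m%:R = 0 :> 'Z_m by rewrite pchar_Zp.
move: T over; rewrite -(csum_arc_total _ ij jn) vl => T.
(* An arc out of range must carry all of the weight [m], leaving 0 to the other arc; both exponents
   are zero modulo [m]. *)
rewrite -(csum_connect w (connect_arc ij jn ln)); case: ifP => _ over.
  have -> : csum (cyc2 i j) w (vv j) = m by lia.
  by rewrite intrM -pmulrn m0 mul0r.
have -> : csum (cyc2 i j) w (vv j) = 0%N by lia.
by rewrite mul0r.
Qed.

Definition phi : chain -> 'Z_m := lext Phi.
HB.instance Definition _ := GRing.Additive.copy phi (lext Phi : chain -> 'Z_m).

Lemma phi_mono H w : phi (mono H w) = Phi H w.
Proof. exact/lext_mono/Phi_invariant. Qed.

(** Adding an edge keeps [w], so the condition in [Phi] factors out and [psi_differential]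
    remains. *)
Lemma phi_diff c : phi (diff leE c) = 0.
Proof.
rewrite diff_dA; elim/chain_ind_all: c => [|a b k Ea Eb|H w]; first by rewrite !raddf0.
  by rewrite !raddfD !raddfMz /= Ea Eb mul0rz addr0.
rewrite dAE raddf_sum /=.
rewrite (eq_bigr (fun e => if e \notin H then Phi (e |: H) w *~ sgn H e else 0)) => [|e _].
  rewrite -big_mkcondr /= /Phi.
  case: ((cyc_total w == m) && _); last by rewrite big1 // => e _; rewrite mul0rz.
  rewrite (eq_bigr (fun e => (psi (partial_sum w) (e |: H) * sgn H e)%:~R)) => [|e _].
    rewrite -mulrz_sumr (eq_bigl (fun e => e \notin H)).
      by rewrite psi_differential.
    by move=> e; rewrite inE.
  by rewrite intrM mulrzr.
rewrite d1_mono; case: ifP => _; rewrite ?raddf0 //= raddfMz /=.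
by rewrite phi_mono.
Qed.

End CycleFunctional.

(** * Composites of differentials along edge classes *)

Section IteratedDifferentials.
Variables (G : multigraph) (leE : rel (edge G)) (m' : nat).
Hypotheses (leE_total : total leE) (leE_anti : antisymmetric leE).
Local Notation chain := {ffun state G m'.+1 -> int}.
Local Notation sgn := (sgn leE).
Local Notation d1 := (@d1 G leE m').
Local Notation dA := (@dA G leE m').
Implicit Types (e : edge G) (H A B F : {set edge G}) (c : chain).
Implicit Type Fs : seq {set edge G}.

Fixpoint Dop Fs c : chain := if Fs is F :: Fs' then Dop Fs' (dA F c) else c.

Lemma Dop_is_zmod_morphism Fs : zmod_morphism (Dop Fs).
Proof. by elim: Fs => //= F Fs IH a b; rewrite raddfB IH. Qed.
HB.instance Definition _ Fs :=
  GRing.isZmodMorphism.Build chain chain (Dop Fs) (Dop_is_zmod_morphism Fs).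

Lemma dA_Dop A Fs c : dA A (Dop Fs c) = Dop Fs (dA A c) *~ (-1) ^+ size Fs.
Proof.
elim: Fs c => [|F Fs IH] c; first by rewrite expr0 mulr1z.
by rewrite /= IH dA_anti // raddfN /= exprS mulN1r mulrNz mulNrz.
Qed.

(** Anticommutation carries [dA F] to the factor [F] of the composite, where the square is zero. *)
Lemma Dop_kill F Fs c : F \in Fs -> Dop Fs (dA F c) = 0.
Proof.
elim: Fs c => // F' Fs IH c; rewrite inE => /orP[/eqP<-|/IH FFs] /=.
  by rewrite dA_sqr // raddf0.
by rewrite dA_anti // raddfN /= FFs oppr0.
Qed.

(** The composite is a combination of [X H'] with [H'] containing [H] and an edge from every class.
    [X] may be any family differentiated like monomials, in particular [fam]. *)
Lemma Dop_vanish Fs (X : {set edge G} -> chain) H :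
  (forall H e, d1 e (X H) = if e \in H then 0 else X (e |: H) *~ sgn H e) ->
  (forall H', H \subset H' -> (forall F, F \in Fs -> F :&: H' != set0) -> X H' = 0) ->
  Dop Fs (X H) = 0.
Proof.
move=> dX; elim: Fs H => [|F Fs IH] H X0 /=; first exact: X0.
rewrite dAE raddf_sum big1 // => e eF; rewrite dX; case: ifP => [_|eH].
  by rewrite raddf0.
rewrite raddfMz /= IH ?mul0rz // => H' HH' FH'; apply: X0.
  by apply: subset_trans HH'; exact: subsetUr.
move=> F'; rewrite inE => /orP[/eqP->|/FH'//]; apply/set0Pn; exists e.
by rewrite inE eF (subsetP HH') // setU11.
Qed.

End IteratedDifferentials.

(** * The torsion class of a chordless cycle *)

Section TorsionChain.
Variables (G : multigraph) (leE : rel (edge G)) (m'' : nat).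
Hypotheses (leE_total : total leE) (leE_anti : antisymmetric leE).
Hypothesis nl : loopless G.
Local Notation m' := m''.+1.
Local Notation m := m'.+1.
Local Notation chain := {ffun state G m -> int}.
Local Notation mono := (@mono G m').
Local Notation sgn := (sgn leE).
Local Notation d1 := (@d1 G leE m').
Local Notation dA := (@dA G leE m').
Implicit Types (e f : edge G) (u v x y : vertex G) (H A B S T : {set edge G}).

Variables (n : nat) (vv : nat -> vertex G) (ee : nat -> edge G).
Hypothesis n3 : (2 < n)%N.
Hypothesis vv_inj : forall i j, (i < n)%N -> (j < n)%N -> vv i = vv j -> i = j.
Hypothesis ee_inj : forall i j, (i < n)%N -> (j < n)%N -> ee i = ee j -> i = j.
Hypothesis eeP : forall i, (i < n)%N -> joins (ee i) (vv i) (vv (i.+1 %% n)).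
Hypothesis chordless : forall e p q, (1 < p)%N -> (p < q)%N -> (q < n)%N ->
  joins e (vv p) (vv q) -> q = p.+1.

(* The vertices v_2, ..., v_(n-1) of the cycle form an induced path, whose edge
   classes are the sets par l with 2 <= l <= n - 2. *)
Definition inP v := [exists l : 'I_n, (1 < l)%N && (v == vv l)].
Definition par l : {set edge G} := [set e | joins e (vv l) (vv l.+1)].
Definition pars := [seq par l | l <- iota 2 (n - 3)].

Lemma inP_P v : reflect (exists2 l, (1 < l < n)%N & v = vv l) (inP v).
Proof.
apply: (iffP existsP) => [[l /andP[l1 /eqP->]]|[l /andP[l1 ln] ->]].
  by exists l; rewrite ?l1 /=.
by exists (Ordinal ln); rewrite /= l1 eqxx.
Qed.

Lemma inP_vv l : (l < n)%N -> inP (vv l) = (1 < l)%N.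
Proof.
move=> ln; apply/inP_P/idP => [[k /andP[k1 kn] /vv_inj E]|l1].
  by rewrite (E ln kn).
by exists l; rewrite ?l1.
Qed.

Lemma joins_neq e u v : joins e u v -> u != v.
Proof.
move=> /joins_inv/(_ (joins_ends e)) E; apply/eqP => uv; apply: (nl (e := e)).
by case: E => -[<- <-].
Qed.

Local Notation weight := {ffun vertex G -> 'I_m}.
Implicit Type w : weight.

(** The defect: how far the labels off the path fall short of the top exponent in total. One unit
    more of defect is balanced by [add1], so both sums in [fam] have the same degree. *)
Definition defi w := (\sum_(v | ~~ inP v) (m' - w v))%N.
Definition zeroP w := [forall v, inP v ==> (w v == 0 :> nat)].
Definition add1 a (w : vertex G -> nat) v := (w v + (v == a))%N.

(* In fam set0 every product over a merged component is either out of range or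
   occurs in both sums, except for an edge avoiding the path: there the m ways to
   write x^m' as a product of two labels give the same monomial. *)
Definition fam H : chain :=
  \sum_(w : weight | zeroP w && (defi w == m'')) mono H (fun v => w v) -
  \sum_(w : weight | zeroP w && (defi w == m')) mono H (add1 (vv 2) (fun v => w v)).

Lemma d1_fam H e : d1 e (fam H) = if e \in H then 0 else fam (e |: H) *~ sgn H e.
Proof.
rewrite {1}/fam raddfB /= [X in X - _]raddf_sum [X in _ - X]raddf_sum; case: ifP => eH.
  by rewrite !big1 ?subr0 // => w _; rewrite /= d1_mono eH.
by rewrite mulrzBl !mulrz_suml; congr (_ - _); apply: eq_bigr => w _; rewrite /= d1_mono eH.
Qed.

Lemma csum_add1 H a (w : vertex G -> nat) v :
  csum H (add1 a w) v = (csum H w v + connect (adj H) v a)%N.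
Proof.
rewrite /csum /add1 big_split /=; congr (_ + _)%N.
case: (boolP (connect _ _ _)) => va.
  rewrite (bigD1 a) ?inE //= eqxx big1 ?addn0 // => u /andP[_ /negPf->] //.
by rewrite big1 // => u; rewrite inE => vu; case: eqP vu va => // -> ->.
Qed.

Lemma defi_ge2 w x y : ~~ inP x -> ~~ inP y -> x != y ->
  ((m' - w x) + (m' - w y) <= defi w)%N.
Proof.
move=> xP yP xy; rewrite /defi (bigD1 x) //= leq_add2l (bigD1 y) ?leq_addr //.
by rewrite yP eq_sym.
Qed.

Section Mixed.
Variable x : vertex G.
Hypothesis xP : ~~ inP x.

Definition shift_up w : weight := [ffun v => if v == x then inord (w x).+1 else w v].
Definition shift_down w : weight := [ffun v => if v == x then inord (w x).-1 else w v].

Lemma defi_shift_up w : (w x < m')%N -> (defi (shift_up w)).+1 = defi w.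
Proof.
move=> wx; rewrite /defi (bigD1 x) //= [in RHS](bigD1 x) //= ffunE eqxx inordK //.
rewrite -addSn; congr (_ + _)%N; first by lia.
by apply: eq_bigr => v /andP[_ /negPf vx]; rewrite ffunE vx.
Qed.

Lemma zeroP_shift_up w : zeroP (shift_up w) = zeroP w.
Proof.
apply: eq_forallb => v; rewrite ffunE; case: (v =P x) => // ->.
by rewrite (negPf xP).
Qed.

(** As [vv 2] and [x] share a component, the extra unit at [vv 2] may be placed at [x]; so
    [shift_up] matches the second sum with the first. Second-sum terms with [w x] equal to [m'] are
    out of range. *)
Lemma fam_mixed0 H : connect (adj H) (vv 2) x -> fam H = 0.
Proof.
move=> cx; rewrite /fam; apply/eqP; rewrite subr_eq0; apply/eqP.
have x2 : (vv 2 == x) = false.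
  by apply: contraNF xP => /eqP<-; rewrite inP_vv.
rewrite (reindex_onto shift_up shift_down) => [|w /andP[zw /eqP dw]]; last first.
  (* Defect [m''] leaves [x] a positive exponent, so [shift_up] undoes [shift_down]. *)
  have wx : (0 < w x)%N.
    by have : (m' - w x <= defi w)%N; [rewrite /defi (bigD1 x) //= leq_addr|lia].
  apply/ffunP => v; rewrite !ffunE eqxx; case: eqP => // ->.
  have wm := ltn_ord (w x).
  have E : nat_of_ord (inord (w x).-1 : 'I_m) = (w x).-1 by rewrite inordK //; lia.
  by apply: ord_inj; rewrite E inordK prednK.
rewrite [RHS](bigID (fun w : weight => (w x < m')%N)) /= [X in _ = _ + X]big1 => [|w]; last first.
  move=> /andP[/andP[zw _] wx]; apply: (@mono_over _ _ _ _ x).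
  have w2 : w (vv 2) = 0%N :> nat by move/forallP/(_ (vv 2)): zw; rewrite inP_vv // => /eqP.
  have := @csum_ge2 _ H (add1 (vv 2) (fun v => w v)) x (vv 2) x.
  rewrite connect0 connect_adj_sym cx eq_sym x2 /add1 eqxx w2 eq_sym x2.
  by move=> /(_ isT isT isT); lia.
rewrite addr0; apply: eq_big => w.
  rewrite zeroP_shift_up -andbA -[in RHS]andbA; congr (_ && _).
  have [wx|wx] := ltnP (w x) m'.
    rewrite -(defi_shift_up wx) eqSS andbT; apply: andb_idr => _.
    apply/eqP/ffunP => v; rewrite !ffunE eqxx; case: eqP => // ->.
    have E : nat_of_ord (inord (w x).+1 : 'I_m) = (w x).+1 by rewrite inordK //; lia.
    by apply: ord_inj; rewrite E inordK //= ltnW.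
  rewrite andbF; apply/negbTE; rewrite negb_and; apply/orP; right.
  (* At the top exponent [inord] overflows to [ord0], so [shift_down] does not undo [shift_up]. *)
  apply/eqP => /ffunP/(_ x); rewrite !ffunE eqxx => /(congr1 val) /=.
  have -> : inord (w x).+1 = ord0 :> 'I_m.
    by rewrite /inord /insubd insubN //; lia.
  by rewrite inordK //=; lia.
move=> /andP[_ /eqP E].
have wx : (w x < m')%N.
  rewrite ltnNge; apply/negP => wx; move/ffunP/(_ x): E; rewrite !ffunE eqxx => /(congr1 val) /=.
  have -> : inord (w x).+1 = ord0 :> 'I_m by rewrite /inord /insubd insubN //; lia.
  by rewrite inordK //=; lia.
apply: mono_ext => v; rewrite csum_add1.
have <- : connect (adj H) v x = connect (adj H) v (vv 2).
  by apply/esym/same_connect_r => //; exact: connect_adj_sym.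
rewrite -csum_add1; apply: eq_bigr => u _; rewrite /add1 ffunE.
by case: eqP => [->|_]; rewrite ?inordK ?addn1 ?addn0.
Qed.

End Mixed.

Section Outer.
Variable e : edge G.
Local Notation x := (ends e).1.
Local Notation y := (ends e).2.
Hypotheses (xP : ~~ inP x) (yP : ~~ inP y).

(** The merged component of [e] has exponent [m'], all of it placed at the second endpoint. *)
Definition outer_weight v : nat :=
  if inP v then nat_of_bool (v == vv 2) else if v == x then 0%N else m'.

Let xy : x != y := joins_neq (joins_ends e).
Let cxy : connect (adj [set e]) x y.
Proof. by apply: connect_joins (joins_ends e); rewrite inE. Qed.

Definition split_weight (k : 'I_m) : weight :=
  [ffun v => if inP v then ord0 else if v == x then k
             else if v == y then inord (m' - k) else ord_max].

(** A product in range on the merged component needs a defect of at least [m'] at [x] and [y]. The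
    first sum has too little. In the second, all defect lies there, so the value at [x] determines
    [w] and each of its [m] values gives the same monomial. *)
Lemma fam_outer : fam [set e] = - mono [set e] outer_weight *+ m.
Proof.
have over (w : weight) : ((m' - w x) + (m' - w y) < m')%N ->
    (m <= csum [set e] (fun v => w v) x)%N.
  move=> d; apply: leq_trans (csum_ge2 (fun v => w v) (connect0 _ x) cxy xy).
  by have := ltn_ord (w x); have := ltn_ord (w y); lia.
rewrite /fam big1 => [|w /andP[_ /eqP dw]]; last first.
  by apply: mono_over (over _ _); have := defi_ge2 w xP yP xy; lia.
rewrite sub0r mulNrn; congr (- _).
rewrite (partition_big (fun w : weight => w x) predT) //=.
rewrite (eq_bigr (fun _ => mono [set e] outer_weight)) => [|k _].
  by rewrite sumr_const card_ord.
have skx : split_weight k x = k by rewrite ffunE (negPf xP) eqxx.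
have sky : split_weight k y = (m' - k)%N :> nat.
  by rewrite ffunE (negPf yP) eq_sym (negPf xy) eqxx inordK //; lia.
have skP : [&& zeroP (split_weight k), defi (split_weight k) == m' & split_weight k x == k].
  rewrite skx eqxx andbT; apply/andP; split.
    by apply/forallP => v; apply/implyP => vP; rewrite ffunE vP.
  rewrite /defi (bigD1 x) //= (bigD1 y) /= ?yP 1?eq_sym // big1 => [|v /andP[/andP[vP vx] vy]].
    by rewrite skx sky addn0; have := ltn_ord k; lia.
  by rewrite ffunE (negPf vP) (negPf vx) (negPf vy) subnn.
rewrite (bigD1 (split_weight k)) /=; last by rewrite -andbA.
rewrite big1 ?addr0 => [|w /andP[/andP[/andP[zw /eqP dw] /eqP wx] wN]]; last first.
  apply: (@mono_over _ _ _ _ x); apply: leq_trans (over w _) _; last first.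
    by rewrite csum_add1 leq_addr.
  have := defi_ge2 w xP yP xy; rewrite dw leq_eqVlt => /orP[/eqP D|//].
  case/eqP: wN.
  have wy : w y = (m' - k)%N :> nat.
    by move: D; rewrite wx; have := ltn_ord (w y); have := ltn_ord k; lia.
  apply/ffunP => v; apply: val_inj; rewrite ffunE.
  case: (boolP (inP v)) => [vP|vP]; first by move/forallP/(_ v): zw; rewrite vP => /eqP.
  case: eqVneq => [->|vx]; first by rewrite wx.
  case: eqVneq => [->|vy]; first by rewrite /= wy inordK //; lia.
  move: dw; rewrite /defi (bigD1 x) //= (bigD1 y) /= ?yP 1?eq_sym //.
  rewrite (bigD1 v) /= ?vP ?vx //; have := ltn_ord (w v); lia.
apply: mono_ext => v; rewrite /csum.
(* Moving the weight of [x] to [y] turns every [split_weight k], with its unit at [vv 2], into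
   [outer_weight]. *)
rewrite -(@sum_move_weight _ y x) 1?eq_sym //; last first.
  by rewrite !inE; apply/esym/same_connect_r => //; exact: connect_adj_sym.
have x2 : (x == vv 2) = false by apply: contraNF xP => /eqP->; rewrite inP_vv.
have y2 : (y == vv 2) = false by apply: contraNF yP => /eqP->; rewrite inP_vv.
apply: eq_bigr => u _; rewrite /move_weight /add1 /outer_weight.
case: eqVneq => [->|ux]; first by rewrite (negPf xP).
case: eqVneq => [->|uy].
  by rewrite (negPf yP) skx sky x2 y2; have := ltn_ord k; lia.
rewrite ffunE (negPf ux) (negPf uy); case: ifP => // uP.
by rewrite (_ : u == vv 2 = false) ?addn0 //; apply: contraFF uP => /eqP->; rewrite inP_vv.
Qed.

End Outer.

Definition outer e := ~~ inP (ends e).1 && ~~ inP (ends e).2.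
Definition inner e := inP (ends e).1 && inP (ends e).2.

(** Since the cycle has no chord, an edge between two path vertices joins consecutive ones. *)
Lemma inner_par e : inner e -> exists2 l, (1 < l < n.-1)%N & e \in par l.
Proof.
case/andP => /inP_P[p /andP[p1 pn] ep] /inP_P[q /andP[q1 qn] eq].
have := joins_ends e; rewrite ep eq => epq.
have : p != q by apply: contraTneq (joins_neq epq) => ->; rewrite eqxx.
rewrite neq_ltn => /orP[pq|qp].
  have E := chordless p1 pq qn epq; exists p; first by lia.
  by rewrite inE -E.
rewrite joinsC in epq; have E := chordless q1 qp pn epq; exists q; first by lia.
by rewrite inE -E.
Qed.

Lemma par_inner e l : (1 < l < n.-1)%N -> e \in par l -> inner e.
Proof.
rewrite inE => ln /joins_inv/(_ (joins_ends e)) E; rewrite /inner.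
have a : inP (vv l) by rewrite inP_vv; lia.
have b : inP (vv l.+1) by rewrite inP_vv; lia.
by case: E => -[<- <-]; rewrite a b.
Qed.

Lemma par_uniq e k l : (k < n.-1)%N -> (l < n.-1)%N -> e \in par k -> e \in par l -> k = l.
Proof.
rewrite !inE => kn ln /joins_inv E /E {E}[] [/vv_inj E1 /vv_inj E2].
  by apply: E1; lia.
have := E1 ltac:(lia) ltac:(lia); have := E2 ltac:(lia) ltac:(lia); lia.
Qed.

Lemma inner_sum (f : edge G -> chain) :
  \sum_(e | inner e) f e = \sum_(l < n | (1 < l < n.-1)%N) \sum_(e in par l) f e.
Proof.
rewrite (exchange_big_dep inner) /=; last by move=> l e ln; exact: par_inner.
apply: eq_bigr => e /inner_par[l ln el].
have ln' : (l < n)%N by lia.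
rewrite (big_pred1 (Ordinal ln')) // => k /=; apply/andP/eqP => [[kn ek]|-> //].
by apply: ord_inj; apply: (par_uniq _ _ ek el); lia.
Qed.

Lemma mem_pars l : (1 < l < n.-1)%N -> par l \in pars.
Proof. by move=> ln; apply: map_f; rewrite mem_iota; lia. Qed.

Lemma Dop_fam_inner : \sum_(e | inner e) Dop leE pars (d1 e (fam set0)) = 0.
Proof.
rewrite inner_sum big1 // => l ln.
rewrite -(raddf_sum (Dop leE pars)) -dAE; apply: Dop_kill => //.
exact: mem_pars.
Qed.

(** After the composite, every class of the path is represented, so the edge [e] connects [vv 2] to
    a vertex off the path and [fam_mixed0] applies. *)
Lemma Dop_fam_mixed e : ~~ inner e -> ~~ outer e -> Dop leE pars (d1 e (fam set0)) = 0.
Proof.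
move=> eI eO.
have [p [x [pP xP px]]] : exists p x, [/\ inP p, ~~ inP x & joins e p x].
  have j := joins_ends e; move: eI eO; rewrite /inner /outer.
  have [a|a] := boolP (inP (ends e).1); have [b|b] := boolP (inP (ends e).2) => // _ _.
    by exists (ends e).1, (ends e).2.
  by exists (ends e).2, (ends e).1; rewrite joinsC.
rewrite d1_fam inE raddfMz /= Dop_vanish ?mul0rz //; first by move=> H f; exact: d1_fam.
move=> H eH parsH; apply: (fam_mixed0 xP).
have up l : (1 < l < n)%N -> connect (adj H) (vv 2) (vv l).
  elim: l => // l IH ln; case: (eqVneq l 1%N) => [->|l1]; first exact: connect0.
  apply: connect_trans (IH _) _; first by lia.
  have ln' : (1 < l < n.-1)%N by lia.
  have /set0Pn[f] := parsH _ (mem_pars ln').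
  by rewrite !inE => /andP[fl fH]; exact: connect_joins fl.
have /inP_P[l ln pl] := pP; apply: connect_trans (up _ ln) _; rewrite -pl.
by apply: connect_joins px; rewrite (subsetP eH) // setU11.
Qed.

Definition torsion_class : chain :=
  \sum_(e | outer e) Dop leE pars (mono [set e] (outer_weight e)) *~ sgn set0 e.

(** Inner and mixed edges contribute nothing, and each outer edge gives [m] copies of one
    monomial. *)
Lemma diff_Dop_fam : diff leE (Dop leE pars (fam set0)) =
  - torsion_class *+ m *~ (-1) ^+ size pars.
Proof.
rewrite diff_dA dA_Dop //; congr (_ *~ _); rewrite dAE raddf_sum.
rewrite (eq_bigl predT) => [|e]; last by rewrite inE.
rewrite (bigID inner) /= Dop_fam_inner add0r (bigID outer) /=.
rewrite [X in _ + X]big1 ?addr0 => [|e /andP[eI eO]]; last exact: Dop_fam_mixed.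
rewrite /torsion_class mulNrn -sumrMnl -sumrN; apply: eq_big => e.
  by rewrite /inner /outer; case: (inP _); case: (inP _).
move=> /andP[_ /andP[xP yP]]; rewrite d1_fam inE raddfMz /= setU0 fam_outer //.
by rewrite mulNrn raddfN raddfMn /= mulNrz !pmulrn mulrzAC.
Qed.

Local Notation phi := (@phi G leE m'' n vv ee).

(** Differentials only add edges, and [Phi] vanishes on subgraphs not contained in the cycle. *)
Lemma phi_out Fs H (w : vertex G -> nat) :
  ~~ (H \subset cyc n ee) -> phi (Dop leE Fs (mono H w)) = 0.
Proof.
elim: Fs H => [|F Fs IH] H HN /=.
  rewrite phi_mono // /Phi; case: ifP => // _.
  have [->//|/psi_neq0[i [j [_ _ HE]]]] := eqVneq (psi leE n ee (partial_sum n vv w) H) 0.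
  case/negP: HN; rewrite HE; apply: subset_trans (subsetDl _ _) _; exact: subsetDl.
rewrite dAE !raddf_sum big1 // => e _ /=; rewrite d1_mono; case: ifP => _; first by rewrite !raddf0.
rewrite !raddfMz /= IH ?mul0rz //; apply: contra HN; apply: subset_trans; exact: subsetUr.
Qed.

Lemma par_cyc l k : (1 < l < n.-1)%N -> (k < n)%N -> ee k \in par l -> k = l.
Proof.
rewrite inE => ln kn /joins_inv/(_ (eeP kn)).
have kn' : (k.+1 %% n < n)%N by rewrite ltn_pmod //; lia.
case=> -[/vv_inj E1 /vv_inj E2]; first by apply/esym/E1; lia.
have {}E1 := E1 ltac:(lia) ltac:(lia); have {}E2 := E2 ltac:(lia) ltac:(lia).
have mk : (k.+1 %% n = if k.+1 == n then 0 else k.+1)%N.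
  by case: eqP => [->|?]; [rewrite modnn|rewrite modn_small //; lia].
by move: E1 E2; rewrite mk; case: eqP; lia.
Qed.

Definition add_edges H (ls : seq nat) := H :|: [set e | has (fun l => e == ee l) ls].

(** In each class only the edge of the cycle counts, its parallel edges lying outside; the composite
    thus adds these edges up to a sign. *)
Lemma phi_Dop ls H (w : vertex G -> nat) : uniq ls -> (forall l, l \in ls -> (1 < l < n.-1)%N) ->
  (forall l, l \in ls -> ee l \notin H) ->
  exists2 s : int, s * s = 1 &
    phi (Dop leE [seq par l | l <- ls] (mono H w)) = Phi leE m'' n vv ee (add_edges H ls) w *~ s.
Proof.
elim: ls H => [|l ls IH] H /= uls lsn lsH.
  exists 1 => //; rewrite mulr1z phi_mono //; congr Phi.
  by apply/setP => e; rewrite !inE orbF.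
case/andP: uls => lls uls; have ln := lsn l (mem_head _ _).
have eln : (l < n)%N by lia.
have elp : ee l \in par l.
  by have := eeP eln; rewrite modn_small ?inE //; lia.
have [|k kls|s ss IHE] := IH (ee l |: H) uls.
- by move=> k kls; apply: lsn; rewrite inE kls orbT.
- rewrite in_setU1 negb_or lsH ?inE ?kls ?orbT // andbT.
  apply: contraNneq lls => /ee_inj E; rewrite -E //.
  by have := lsn k; rewrite inE kls orbT => /(_ isT); lia.
exists (s * sgn H (ee l)); first by rewrite mulrACA ss sgn_sqr mulr1.
rewrite dAE (big_setD1 (ee l)) //= raddfD raddfD /= d1_mono (negPf (lsH l (mem_head _ _))).
rewrite !raddfMz /= IHE !raddf_sum big1 ?addr0 => [|e /setD1P[el ep]].
  have -> : add_edges (ee l |: H) ls = add_edges H (l :: ls).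
    by apply/setP => e; rewrite !inE orbCA orbA.
  by rewrite [RHS]mulrzA.
rewrite d1_mono; case: ifP => _; first by rewrite !raddf0.
rewrite !raddfMz /= phi_out ?mul0rz //; apply: contra el => /subsetP/(_ e).
rewrite setU11 => /(_ isT)/cycP[k kn E]; rewrite E in ep *.
by rewrite (par_cyc ln kn ep).
Qed.

Lemma outer_ee0 : outer (ee 0).
Proof.
have n0 : (0 < n)%N by lia.
have := eeP n0; rewrite modn_small; last by lia.
have a : inP (vv 0%N) = false by rewrite inP_vv.
have b : inP (vv 1%N) = false by rewrite inP_vv //; lia.
by move=> /joins_inv/(_ (joins_ends _)) E; rewrite /outer; case: E => -[<- <-]; rewrite a b.
Qed.

Lemma outer_cyc e : outer e -> e \in cyc n ee -> e = ee 0%N.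
Proof.
move=> eO /cycP[k kn ke]; have kn' : (k.+1 %% n < n)%N by rewrite ltn_pmod //; lia.
have [] : ~~ inP (vv k) /\ ~~ inP (vv (k.+1 %% n)).
  move: eO; rewrite ke => /andP[a b].
  by have [] := joins_inv (eeP kn) (joins_ends _) => -[-> ->].
rewrite !inP_vv // -!leqNgt => k1 k2; rewrite ke; congr ee.
move: k2; rewrite modn_small; lia.
Qed.

Lemma add_edges_cyc : add_edges [set ee 0%N] (iota 2 (n - 3)) = cyc2 n ee 1 n.-1.
Proof.
have en := @ee_neq _ n ee ee_inj.
apply/setP => e; apply/setUP/cyc2P => [[/set1P->|]|[k [kn k1 kn1 ->]]].
- by exists 0%N; split=> //; rewrite ?en //; lia.
- rewrite inE => /hasP[l]; rewrite mem_iota => ln /eqP->.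
  by exists l; split=> //; rewrite ?en //; lia.
have [->|k0] := eqVneq k 0%N; first by left; rewrite inE.
right; rewrite inE; apply/hasP; exists k => //; rewrite mem_iota.
have : k != 1%N by apply: contraNneq k1 => ->.
have : k != n.-1 by apply: contraNneq kn1 => ->.
lia.
Qed.

(** The arc from [vv 2] to [vv n.-1] carries weight 1, all at [vv 2], and the other arc carries
    [m'], so the cycle total is [m]. *)
Lemma Phi_outer : exists2 s : int, s * s = 1 &
  Phi leE m'' n vv ee (cyc2 n ee 1 n.-1) (outer_weight (ee 0%N)) = s%:~R.
Proof.
have n0 : (0 < n)%N by lia.
have n1 : (1 < n)%N by lia.
have l1 : (1 < n.-1)%N by lia.
have l2 : (n.-1 < n)%N by lia.
have [s ss ->] := Phi_cyc2 m'' leE_total leE_anti n3 vv_inj ee_inj eeP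
  (outer_weight (ee 0%N)) l1 l2.
exists s => //.
have j0 : joins (ee 0%N) (vv 0%N) (vv 1%N) by have := eeP n0; rewrite modn_small.
have v01 : (vv 0%N == vv 1%N) = false by apply/eqP => /vv_inj E; have := E n0 n1.
have [w2 w3] : outer_weight (ee 0%N) (vv 2) = 1%N /\
    forall k, (2 < k < n)%N -> outer_weight (ee 0%N) (vv k) = 0%N.
  split; rewrite /outer_weight; first by rewrite inP_vv // eqxx.
  move=> k /andP[k2 kn]; rewrite inP_vv // (ltnW k2); case: eqP => // /vv_inj E.
  by have := E kn n3; lia.
have w01 : (outer_weight (ee 0%N) (vv 0%N) + outer_weight (ee 0%N) (vv 1%N) = m')%N.
  rewrite /outer_weight !inP_vv //=.
  by have [[<- _]|[_ <-]] := joins_inv j0 (joins_ends _);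
    rewrite eqxx ?(eq_sym (vv 1%N)) v01 ?addn0.
rewrite (csum_arc n3 vv_inj ee_inj eeP) //.
have -> : in_arc 1 n.-1 n.-1 by rewrite /in_arc; lia.
have -> : (\sum_(k < n | in_arc 1 n.-1 k == true) outer_weight (ee 0%N) (vv k) = 1)%N.
  rewrite (bigD1 (Ordinal n3)) /= ?w2 ?big1 // => [k|]; last by rewrite /in_arc; lia.
  rewrite /in_arc -val_eqE /= => kk; apply: w3; lia.
have -> : cyc_total n vv (outer_weight (ee 0%N)) = m.
  rewrite /cyc_total (bigD1 (Ordinal n0)) //= (bigD1 (Ordinal n1)) //= (bigD1 (Ordinal n3)) //=.
  rewrite big1 => [|k]; last first.
    by rewrite -!val_eqE /= => kk; apply: w3; have := ltn_ord k; lia.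
  by rewrite w2 addnA w01 addn0 addn1.
rewrite eqxx mul1r (_ : [forall v, _]) //; apply/forallP => v.
case: (boolP (on_cyc n vv v)) => //= vN; rewrite /outer_weight.
have -> : inP v = false.
  by apply: contraNF vN => /inP_P[l /andP[_ ln] ->]; apply/on_cycP; exists l.
case: (v =P (ends (ee 0%N)).1) => [vE|_]; last by rewrite eqxx.
case/negP: vN; apply/on_cycP.
by have [] := joins_inv j0 (joins_ends _) => -[a b];
  [exists 0%N|exists 1%N]; rewrite // vE.
Qed.

(** Among outer edges only [ee 0] lies on the cycle, and its term evaluates to a sign. *)
Lemma phi_torsion_class : phi torsion_class != 0.
Proof.
rewrite raddf_sum (bigD1 (ee 0%N)) ?outer_ee0 //= big1 ?addr0 => [|e /andP[eO e0]]; last first.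
  rewrite raddfMz /= phi_out ?mul0rz //; rewrite sub1set; apply: contra e0.
  by move=> /(outer_cyc eO)->.
have [||l|s ss E] := @phi_Dop (iota 2 (n - 3)) [set ee 0%N] (outer_weight (ee 0%N)).
- exact: iota_uniq.
- by move=> l; rewrite mem_iota; lia.
- by rewrite mem_iota inE => ln; rewrite (@ee_neq _ n) //; lia.
rewrite raddfMz /= E add_edges_cyc; have [r rr ->] := Phi_outer.
(* [t] squares to 1, hence is nonzero modulo [m]. *)
rewrite -!mulrzA; set t := _ * _; have tt : t * t = 1.
  by rewrite /t mulrACA rr mul1r mulrACA ss sgn_sqr mulr1.
apply/eqP => t0; have : (t * t)%:~R = 0 :> 'Z_m by rewrite intrM t0 mul0r.
by rewrite tt => /eqP; rewrite oner_eq0.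
Qed.

Lemma torsion_of_cycle : has_torsion_dividing (chromatic_homology leE m) m.
Proof.
pose s : int := (-1) ^+ size pars; have ss : s * s = 1 by rewrite -expr2 sqrr_sign.
(* The factor [s] and the minus sign in [y] cancel the signs of [diff_Dop_fam]. *)
apply: (functional_torsion (phi := phi) leE_total leE_anti
  (y := - Dop leE pars (fam set0) *~ s) (z := torsion_class)).
- by move=> c; apply: phi_diff.
- rewrite raddfMz raddfN /= diff_Dop_fam -/s.
  by rewrite mulNrn !mulNrz opprK -mulrzA ss mulr1z.
exact: phi_torsion_class.
Qed.

End TorsionChain.

(** * Torsion and cycles of length at least 3: both implications *)

Section CycleTorsion.
Variables (G : multigraph) (leE : rel (edge G)) (m'' : nat).
Hypotheses (leE_total : total leE) (leE_anti : antisymmetric leE).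
Local Notation m := m''.+2.

(* A chord between two vertices of a cycle of minimal length would cut off a
   shorter one. *)
Lemma torsion_of_has_cycle : loopless G -> (exists2 k, (3 <= k)%N & has_cycle G k) ->
  has_torsion_dividing (chromatic_homology leE m) m.
Proof.
move=> nl [k0 k03 hk0].
have ex : exists k, (3 <= k)%N && `[< has_cycle G k >].
  by exists k0; rewrite k03; apply/asboolP.
case: (ex_minnP ex) => n /andP[n3 /asboolP[v [e [vI eI ve]]]] nmin.
case: n => // n' in n3 v e vI eI ve nmin *; set n := n'.+1 in n3 v e vI eI ve nmin *.
pose vv i := v (inord i); pose ee i := e (inord i).
have vv_inj i j : (i < n)%N -> (j < n)%N -> vv i = vv j -> i = j.
  by move=> ilt jlt /vI/(congr1 val) /=; rewrite !inordK.
have ee_inj i j : (i < n)%N -> (j < n)%N -> ee i = ee j -> i = j.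
  by move=> ilt jlt /eI/(congr1 val) /=; rewrite !inordK.
have eeP i : (i < n)%N -> joins (ee i) (vv i) (vv (i.+1 %% n)%N).
  move=> ilt; have := ve (inord i); rewrite /ee /vv.
  suff -> : ordS (inord i) = inord (i.+1 %% n)%N :> 'I_n by [].
  by apply: ord_inj; rewrite /= !inordK // ltn_pmod.
apply: (@torsion_of_cycle G leE m'' leE_total leE_anti nl n vv ee) => //.
move=> f p q p1 pq qn fpq; apply/eqP; apply: contraT => qp.
have q2 : (2 < (q - p).+1)%N by lia.
suff hc : has_cycle G (q - p).+1.
  by have := nmin (q - p).+1; rewrite q2 asboolT // => /(_ isT); rewrite /n in qn *; lia.
apply: (has_cycle_seq (f := fun i => vv (p + i)%N)) => //.
- by move=> i j ilt jlt /vv_inj E; have := E ltac:(lia) ltac:(lia); lia.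
- move=> i ilt; have pin : (p + i < n)%N by lia.
  have := eeP _ pin; rewrite modn_small; last by lia.
  by rewrite addnS => J; apply/adjP; exists (ee (p + i)%N).
apply/adjP; exists f => //=; rewrite addn0 subnKC; last by lia.
by rewrite joinsC.
Qed.

Lemma exact_no_torsion : exact_on leE m''.+1 setT ->
  ~ has_torsion (chromatic_homology leE m).
Proof.
move=> ex; apply: exact_torsion_free => c cs dc.
have [||b _ db] := ex c; last by exists b; rewrite diff_dA.
  apply/forallP => s; apply/implyP => /cs ->; by rewrite subsetT.
by rewrite -diff_dA.
Qed.

Lemma torsion_has_cycle : has_torsion (chromatic_homology leE m) ->
  loopless G /\ exists2 k, (3 <= k)%N & has_cycle G k.
Proof.
move=> tors; have nl : loopless G.
  move=> e le; apply: exact_no_torsion tors.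
  exact: (exact_on_loop leE_total leE_anti le).
split=> //; apply: contrapT => nc; apply: exact_no_torsion tors.
apply: exact_on_forest => // k k3 hk; apply: nc; by exists k.
Qed.

End CycleTorsion.

Theorem theorem4p10 (m : nat) (hm : (2 <= m)%N) (G : multigraph)
    (leE : rel (edge G)) (leE_total : total leE)
    (leE_anti : antisymmetric leE) (leE_trans : transitive leE) :
  (has_torsion (chromatic_homology leE m) <->
     loopless G /\ exists2 k, (3 <= k)%N & has_cycle G k) /\
  (loopless G /\ (exists2 k, (3 <= k)%N & has_cycle G k) ->
     has_torsion_dividing (chromatic_homology leE m) m).
Proof.
case: m hm => [|[|m'']] // _.
have dividing : loopless G /\ (exists2 k, (3 <= k)%N & has_cycle G k) ->
    has_torsion_dividing (chromatic_homology leE m''.+2) m''.+2.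
  by case; exact: torsion_of_has_cycle.
split=> //; split; first exact: torsion_has_cycle.
by case/dividing=> a [n [a0 an _]]; exists a, n.
Qed.
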